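(* Let $(\mathscr{C},s,f)$ be a framed $1$-flow category and let $\varphi\in C^k(\mathscr{C};\mathbb{Z}/2)$ be a cocycle. Then the cochain $\operatorname{sq}^\varphi\in C^{k+2}(\mathscr{C};\mathbb{Z}/2)$ (defined using a choice of combinatorial boundary matching for $\varphi$) is a cocycle, and the cohomology class of $\operatorname{sq}^\varphi$ does not depend on the choice of combinatorial boundary matching for $\varphi$. Furthermore, there is a well-defined linear map $$\operatorname{Sq}^2\colon H^k(\mathscr{C};\mathbb{Z}/2)\to H^{k+2}(\mathscr{C};\mathbb{Z}/2),\qquad z\mapsto[\operatorname{sq}^\varphi],$$ where $\varphi$ is any choice of cocycle representing the cohomology class $z$.
   Context: Signs and framing values lie in $\{0,1\}$, identified with $\mathbb{Z}/2$; sums of them are taken in $\mathbb{Z}/2$. **1-flow categories.** A $1$-flow category $\mathscr{C}$ consists of a finite set $\operatorname{Ob}(\mathscr{C})$, a grading $|\cdot|\colon\operatorname{Ob}(\mathscr{C})\to\mathbb{Z}$, and for each pair $a,b\in\operatorname{Ob}(\mathscr{C})$ with $|a|-|b|\in\{1,2\}$ a compact manifold $\mathcal{M}(a,b)$ (moduli space) of dimension $|a|-|b|-1$, such that whenever $|a|-|c|=2$, $$\partial\mathcal{M}(a,c)=\coprod_{|b|=|a|-1}\mathcal{M}(b,c)\times\mathcal{M}(a,b).$$ For $|a|-|d|=3$ one defines $$\partial\mathcal{M}(a,d)=\coprod_{|b|=|a|-1}\mathcal{M}(b,d)\times\mathcal{M}(a,b)\ \cup\coprod_{|c|=|a|-2}\mathcal{M}(c,d)\times\mathcal{M}(a,c),$$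 where the two disjoint unions share the common subset $\coprod_{|b|=|c|+1=|d|+2}\mathcal{M}(c,d)\times\mathcal{M}(b,c)\times\mathcal{M}(a,b)$. Every component of $\partial\mathcal{M}(a,d)$ is homeomorphic to a circle. A sign assignment $s$ assigns $s(P)\in\{0,1\}$ to every point $P$ of a $0$-dimensional moduli space so that if $(P_1,Q_1)\in\mathcal{M}(b_1,c)\times\mathcal{M}(a,b_1)$ and $(P_2,Q_2)\in\mathcal{M}(b_2,c)\times\mathcal{M}(a,b_2)$ are the two endpoints of an interval component of $\mathcal{M}(a,c)$, then $s(P_1)+s(Q_1)+s(P_2)+s(Q_2)=1$. A pre-framing $f$ assigns $f(K)\in\{0,1\}$ to every component $K$ (interval or circle) of a $1$-dimensional moduli space. A circle is non-trivially framed if its value is $1$. For a component $K$ of $\partial\mathcal{M}(a,d)$, $|a|-|d|=3$, define $\tilde f(K)\in\mathbb{Z}/2$: if $K$ is of the form $\{P\}\times S^1\subset\mathcal{M}(c,d)\times\mathcal{M}(a,c)$ or $S^1\times\{Q\}\subset\mathcal{M}(b,d)\times\mathcal{M}(a,b)$ with $S^1$ a circle component, then $\tilde f(K)=1+f(S^1)$; otherwise $K$ is a union of intervals $I\times\{Q\}\subset\mathcal{M}(b,d)\times\mathcal{M}(a,b)$ and $\{P\}\times J\subset\mathcal{M}(c,d)\times\mathcal{M}(a,c)$, and $\tilde f(K)=\sum_{I\times\{Q\}}f(I)+\sum_{\{P\}\times J}(1+s(P)+f(J))$. The triple $(\mathscr{C},s,f)$ is a framed $1$-flow category if for all $a,d$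 with $|a|=|d|+3$ one has $\sum_K(1+\tilde f(K))=0\in\mathbb{Z}/2$, the sum over all components $K$ of $\partial\mathcal{M}(a,d)$ (compatibility condition). For $|a|=|b|+1$ let $[a:b]=\sum_{A\in\mathcal{M}(a,b)}(-1)^{s(A)}\in\mathbb{Z}$. The chain complex $C_*(\mathscr{C})$ is free over $\mathbb{Z}$ on the objects, graded by $|\cdot|$, with $\partial a=\sum_{|b|=|a|-1}[a:b]\,b$. $C^*(\mathscr{C};\mathbb{Z}/2)$ and $H^*(\mathscr{C};\mathbb{Z}/2)$ are the associated cochain complex and cohomology with $\mathbb{Z}/2$-coefficients. A cochain $\varphi\in C^k(\mathscr{C};\mathbb{Z}/2)$ is a function from objects of degree $k$ to $\mathbb{Z}/2$; it is represented by $c_1,\dots,c_l$ if these are exactly the objects where $\varphi$ takes value $1$. **Special graph structures.** A special graph structure $\Gamma=\Gamma(V,E,E',E'',L,s,f)$ consists of finite sets: a vertex set $V$ with $s\colon V\to\{0,1\}$; a set $E$ of edges (each edge $e$ has a two-element set of endpoints in $V$; an edge of $E'$ and an edge of $E-E'$ may have the same endpoints); a subset $E'\subset E$ with $f\colon E'\to\{0,1\}$; a subset $E''\subset E-E'$ of directed edges (each with a chosen endpoint towards which it points); and a set $L$ of loops (abstract elements, unrelated to $E$). Conditions: (1) each vertex lies in at least one and at most two edges; those in exactly one edge form the boundary $\partial V$; (2) the unique edge containing a vertex of $\partial V$ lies in $E'$; (3) each vertex of $V-\partial V$ lies in one edge of $E'$ and one edge of $E-E'$; (4) the endpoints of an edge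 in $E'$ have different values of $s$; (5) the endpoints of an edge in $E-E'$ have equal values of $s$ if and only if the edge is in $E''$. The components of $\Gamma$ are the classes of $V$ under the equivalence relation generated by the edges, together with the elements of $L$. For a component $K$ containing a vertex, $F(K)\in\mathbb{Z}/2$ is the sum of $f(e')$ over the edges $e'\in E'$ in $K$; if moreover $K$ is a circle, $D(K)\in\mathbb{Z}/2$ is the number mod $2$ of directed edges in $K$ pointing in a chosen direction around $K$ (independent of the direction). **The graph $\Gamma(a,c)$.** For $|a|-|c|=2$: vertices are the points $(B,A)\in\mathcal{M}(b,c)\times\mathcal{M}(a,b)$ over all $b$, with $s(B,A)=s(B)+s(A)$; $E=E'$ is the set of interval components of $\mathcal{M}(a,c)$, each joining its endpoints, with framing values given by $f$; $L$ is the set of non-trivially framed circles in $\mathcal{M}(a,c)$. **Combinatorial boundary matchings and $\operatorname{sq}^\varphi$.** Let $\varphi\in C^k(\mathscr{C};\mathbb{Z}/2)$ be a cocycle represented by $c_1,\dots,c_l$, and let $b_1,\dots,b_m$ be all objects of degree $k+1$ with $\mathcal{M}(b_i,c_j)\ne\emptyset$ for some $j$. The set $\mathcal{M}(b_i,\varphi)=\bigcup_j\mathcal{M}(b_i,c_j)$ (disjoint union) has even cardinality. A combinatorial boundary matching $\mathcal{C}$ for $\varphi$ is a choice, for each $i$, of a partition of $\mathcal{M}(b_i,\varphi)$ into ordered pairs. For an object $a$ with $|a|=k+2$, $\Gamma_{\mathcal{C}}(a,\varphi)$ is obtained from the disjoint union of the $\Gamma(a,c_j)$ by adding, for each pair $(B_1,B_2)$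 in $\mathcal{C}$ with $B_1,B_2\in\mathcal{M}(b_i,\varphi)$ and each $A\in\mathcal{M}(a,b_i)$, an edge of $E-E'$ between $(B_1,A)$ and $(B_2,A)$, directed towards $(B_2,A)$ if $s(B_1)=s(B_2)$ and undirected otherwise. Its components are circles and loops. Define $$\operatorname{sq}^\varphi(a)=|L|+\sum_{K}(1+F(K)+D(K))\in\mathbb{Z}/2,$$ where $L$ is the loop set of $\Gamma_{\mathcal{C}}(a,\varphi)$ and $K$ runs over the components containing a vertex. *)

(* Defs.v *)
From HB Require Import structures.
From mathcomp Require Import all_boot all_order all_algebra.

Set Implicit Arguments.
Unset Strict Implicit.
Unset Printing Implicit Defensive.

Import GRing.Theory.

Local Open Scope ring_scope.
Local Open Scope quotient_scope.

Section VspaceQuotient.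
Variables (K : fieldType) (vT : vectType K) (Z B : {vspace vT}).

Definition vquot_rel : {pred subvs_of Z} := [pred z | vsval z \in B].

Fact vquot_rel_zmod_closed : zmod_closed vquot_rel.
Proof.
split=> [|x y]; rewrite !inE ?linear0 ?mem0v // => xB yB.
by rewrite linearB rpredB.
Qed.

HB.instance Definition _ :=
  GRing.isZmodClosed.Build _ vquot_rel vquot_rel_zmod_closed.

(* The vector space Z / (Z :&: B). *)
Definition vquot := Quotient.quot vquot_rel.

HB.instance Definition _ := GRing.Zmodule.on vquot.
HB.instance Definition _ := Quotient.on vquot.

Lemma vquot_eqP (x y : subvs_of Z) :
  reflect (\pi_vquot x = \pi_vquot y) (vsval x - vsval y \in B).
Proof.
have -> : (vsval x - vsval y \in B) = ((x - y) \in vquot_rel).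
  by rewrite [RHS]inE linearB.
rewrite (Quotient.idealrBE vquot_rel); exact: eqP.
Qed.

Lemma vquot_addE (x y : subvs_of Z) :
  \pi_vquot x + \pi_vquot y = \pi_vquot (x + y).
Proof. by rewrite !piE. Qed.

Definition vquot_scale (c : K) (x : vquot) : vquot := \pi_vquot (c *: repr x).

Lemma vquot_scaleE c (x : subvs_of Z) :
  vquot_scale c (\pi_vquot x) = \pi_vquot (c *: x).
Proof.
apply/vquot_eqP; rewrite -linearB -scalerBr linearZ rpredZ //=.
by apply/(vquot_eqP (repr _) x); rewrite reprK.
Qed.

Fact vquot_scaleA a b (x : vquot) :
  vquot_scale a (vquot_scale b x) = vquot_scale (a * b) x.
Proof. by rewrite -[x]reprK (vquot_scaleE b) !vquot_scaleE scalerA. Qed.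

Fact vquot_scale1 : left_id 1 vquot_scale.
Proof. by move=> x; rewrite -[x]reprK vquot_scaleE scale1r. Qed.

Fact vquot_scaleDr : right_distributive vquot_scale +%R.
Proof.
move=> c x y; rewrite -[x]reprK -[y]reprK vquot_addE !vquot_scaleE.
by rewrite vquot_addE scalerDr.
Qed.

Fact vquot_scaleDl (x : vquot) : {morph vquot_scale^~ x : a b / a + b}.
Proof.
by move=> a b; rewrite -[x]reprK !vquot_scaleE vquot_addE scalerDl.
Qed.

HB.instance Definition _ := GRing.Zmodule_isLmodule.Build K vquot
  vquot_scaleA vquot_scale1 vquot_scaleDr vquot_scaleDl.

End VspaceQuotient.

(* A compact 0-manifold is a finite set of points, and a compact 1-manifold   *)
(* is a finite disjoint union of intervals and circles, so the latter is      *)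
(* given by its finite set of components together with, for each component,   *)
(* its set of boundary points: two for an interval, none for a circle.        *)
(*   The moduli spaces are given by their total spaces: fc_pt is the disjoint *)
(* union of all the 0-dimensional ones and fc_cmp is the set of components of *)
(* all the 1-dimensional ones, fibred over pairs of objects by (fc_psrc,      *)
(* fc_ptgt) and (fc_csrc, fc_ctgt); see mod0 and mod1 for the fibres.         *)
(*   A pair (B, A) with B in M(b,c) and A in M(a,b) is a boundary point of    *)
(* M(a,c); fc_bdP says that every boundary point is of this form, and         *)
(* fc_bd_partition that every such pair is a boundary point exactly once.     *)
Record flow1cat := Flow1cat {
  fc_ob : finType;
  fc_gr : fc_ob -> int;
  fc_pt : finType;
  fc_psrc : fc_pt -> fc_ob;
  fc_ptgt : fc_pt -> fc_ob;
  fc_pt_gr : forall P, fc_gr (fc_psrc P) = fc_gr (fc_ptgt P) + 1;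
  fc_cmp : finType;
  fc_csrc : fc_cmp -> fc_ob;
  fc_ctgt : fc_cmp -> fc_ob;
  fc_cmp_gr : forall K, fc_gr (fc_csrc K) = fc_gr (fc_ctgt K) + 2;
  fc_bd : fc_cmp -> {set fc_pt * fc_pt};
  fc_bd_card : forall K, #|fc_bd K| = 0%N \/ #|fc_bd K| = 2%N;
  fc_bdP : forall K B A, (B, A) \in fc_bd K ->
    [/\ fc_ptgt B = fc_ctgt K, fc_psrc B = fc_ptgt A & fc_psrc A = fc_csrc K];
  fc_bd_partition : forall B A, fc_psrc B = fc_ptgt A ->
    #|[set K | (B, A) \in fc_bd K]| = 1%N
}.

Section Flow1Category.
Variable X : flow1cat.
Notation Ob := (fc_ob X).
Notation pt := (fc_pt X).
Notation cmp := (fc_cmp X).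

Definition mod0 (a b : Ob) : {set pt} :=
  [set P | (fc_psrc P == a) && (fc_ptgt P == b)].

Definition mod1 (a c : Ob) : {set cmp} :=
  [set K | (fc_csrc K == a) && (fc_ctgt K == c)].

Definition is_interval (K : cmp) := #|fc_bd K| == 2%N.
Definition is_circle (K : cmp) := #|fc_bd K| == 0%N.

Definition sign_assignment (s : pt -> 'F_2) : Prop :=
  forall (K : cmp) (P1 Q1 P2 Q2 : pt),
    (P1, Q1) != (P2, Q2) -> fc_bd K = [set (P1, Q1); (P2, Q2)] ->
    s P1 + s Q1 + s P2 + s Q2 = 1.

(* Pieces of the boundary of M(a,d), |a| = |d| + 3: inl (J, Q) stands for     *)
(* J x {Q} in M(b,d) x M(a,b) and inr (P, J) for {P} x J in M(c,d) x M(a,c).  *)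
Definition piece : finType := (cmp * pt + pt * cmp)%type.

Definition bd_pieces (a d : Ob) : {set piece} := [set x : piece |
  match x with
  | inl (J, Q) =>
      [&& fc_psrc Q == a, fc_csrc J == fc_ptgt Q & fc_ctgt J == d]
  | inr (P, J) =>
      [&& fc_csrc J == a, fc_psrc P == fc_ctgt J & fc_ptgt P == d]
  end].

(* The end points of a piece, in M(c,d) x M(b,c) x M(a,b). *)
Definition corners (x : piece) : {set pt * pt * pt} :=
  match x with
  | inl (J, Q) => [set (v.1, v.2, Q) | v in fc_bd J]
  | inr (P, J) => [set (P, v.1, v.2) | v in fc_bd J]
  end.

Definition glued (a d : Ob) : rel piece := [rel x y |
  [&& x \in bd_pieces a d, y \in bd_pieces a d
    & corners x :&: corners y != set0]].

(* The components of the boundary of M(a,d), each given by its set of pieces. *)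
Definition bd_components (a d : Ob) : {set {set piece}} :=
  equivalence_partition (connect (glued a d)) (bd_pieces a d).

Definition piece_cmp (x : piece) : cmp :=
  match x with inl (J, _) => J | inr (_, J) => J end.

Definition tilde_frame (s : pt -> 'F_2) (f : cmp -> 'F_2) (K : {set piece}) :
    'F_2 :=
  if [pick x in K | is_circle (piece_cmp x)] is Some x then
    1 + f (piece_cmp x)
  else
    \sum_(x in K)
      match x with inl (J, _) => f J | inr (P, J) => 1 + s P + f J end.

Definition compatibility (s : pt -> 'F_2) (f : cmp -> 'F_2) : Prop :=
  forall a d : Ob, fc_gr a = fc_gr d + 3 ->
    \sum_(K in bd_components a d) (1 + tilde_frame s f K) = 0.

End Flow1Category.

Record framed_flow1cat := FramedFlow1cat {
  ffc_cat :> flow1cat;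
  ffc_s : fc_pt ffc_cat -> 'F_2;
  ffc_f : fc_cmp ffc_cat -> 'F_2;
  ffc_signP : sign_assignment ffc_s;
  ffc_compatP : compatibility ffc_s ffc_f
}.

Section Cohomology.
Variable X : framed_flow1cat.
Notation Ob := (fc_ob X).
Notation pt := (fc_pt X).

Definition incidence (a b : Ob) : int :=
  \sum_(A in mod0 a b) (-1) ^+ (ffc_s A : nat).

Definition obdeg (k : int) : finType := {a : Ob | fc_gr a == k}.

(* The regular algebra ('F_2)^o is 'F_2 seen as a vector space over itself. *)
Notation cochain k := {ffun obdeg k -> ('F_2)^o}.

(* The chain group in degree k is free on obdeg k and the boundary of a is    *)
(* the sum of the (incidence a b) b over b in degree |a| - 1; the coboundary  *)
(* is its dual with mod 2 coefficients. It is only used when k = j + 1, and   *)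
(* depends on both degrees to avoid casts between k and k - 1 + 1.            *)
Definition coboundary (j k : int) (phi : cochain j) : cochain k :=
  [ffun a => \sum_(b : obdeg j) (incidence (val a) (val b))%:~R * phi b].

Fact coboundary_linear j k : linear (@coboundary j k).
Proof.
move=> c u v; apply/ffunP=> a; rewrite !ffunE scaler_sumr -big_split /=.
by apply: eq_bigr => b _; rewrite !ffunE mulrDr; congr (_ + _); apply: mulrCA.
Qed.

HB.instance Definition _ j k :=
  GRing.isLinear.Build _ _ _ _ (@coboundary j k) (@coboundary_linear j k).

Definition cocycles (k : int) : {vspace cochain k} :=
  lker (linfun (@coboundary k (k + 1))).

Definition coboundaries (k : int) : {vspace cochain k} :=
  limg (linfun (@coboundary (k - 1) k)).

Definition cohomology (k : int) := vquot (cocycles k) (coboundaries k).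

HB.instance Definition _ k := GRing.Lmodule.on (cohomology k).

(* Meaningful when phi is a cocycle, in which case vsproj only coerces phi    *)
(* to the type of cocycles.                                                   *)
Definition cohom_class k (phi : cochain k) : cohomology k :=
  \pi_(vquot (cocycles k) (coboundaries k)) (vsproj (cocycles k) phi).

Lemma cohom_class_eq k (phi psi : cochain k) :
    phi \in cocycles k -> psi \in cocycles k ->
  cohom_class phi = cohom_class psi <-> phi - psi \in coboundaries k.
Proof.
move=> Zphi Zpsi; rewrite -{2}(vsprojK Zphi) -{2}(vsprojK Zpsi).
by split=> /vquot_eqP.
Qed.

(* The objects c_1, ..., c_l representing phi. *)
Definition rep_obs k (phi : cochain k) : {set Ob} :=
  [set val c | c : obdeg k & phi c == 1].

End Cohomology.

Notation cochain X k := {ffun obdeg X k -> ('F_2)^o}.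

(* The finite sets V, E' <= E, E'' <= E and L are subsets of ambient finite   *)
(* types; only the values of the functions on these sets matter. A directed   *)
(* edge e points towards v when sg_head e = Some v.                           *)
Record special_graph := SpecialGraph {
  sg_vT : finType;
  sg_eT : finType;
  sg_lT : finType;
  sg_V : {set sg_vT};
  sg_E : {set sg_eT};
  sg_E1 : {set sg_eT};
  sg_E2 : {set sg_eT};
  sg_L : {set sg_lT};
  sg_ends : sg_eT -> {set sg_vT};
  sg_head : sg_eT -> option sg_vT;
  sg_s : sg_vT -> 'F_2;
  sg_f : sg_eT -> 'F_2;
  sg_endsP : forall e, e \in sg_E ->
    sg_ends e \subset sg_V /\ #|sg_ends e| = 2%N;
  sg_E1P : sg_E1 \subset sg_E;
  sg_E2P : sg_E2 \subset sg_E :\: sg_E1;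
  sg_headP : forall e, e \in sg_E2 ->
    exists2 v, sg_head e = Some v & v \in sg_ends e;
  sg_deg1or2 : forall v, v \in sg_V ->
    (1 <= #|[set e in sg_E | v \in sg_ends e]| <= 2)%N;
  sg_boundary := [set v in sg_V | #|[set e in sg_E | v \in sg_ends e]| == 1%N];
  sg_boundaryP : forall v e, v \in sg_boundary -> e \in sg_E ->
    v \in sg_ends e -> e \in sg_E1;
  sg_interiorP : forall v, v \in sg_V :\: sg_boundary ->
    #|[set e in sg_E1 | v \in sg_ends e]| = 1%N /\
    #|[set e in sg_E :\: sg_E1 | v \in sg_ends e]| = 1%N;
  sg_signE1 : forall e v w, e \in sg_E1 -> sg_ends e = [set v; w] -> v != w ->
    sg_s v != sg_s w;
  sg_signE2 : forall e v w, e \in sg_E :\: sg_E1 ->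
    sg_ends e = [set v; w] -> v != w -> (sg_s v == sg_s w) = (e \in sg_E2)
}.

Section SpecialGraph.
Variable G : special_graph.

Definition sg_adj : rel (sg_vT G) := [rel v w |
  [exists e in sg_E G, (v \in sg_ends e) && (w \in sg_ends e)]].

(* The components containing a vertex, each given by its set of vertices. *)
Definition sg_components : {set {set sg_vT G}} :=
  equivalence_partition (connect sg_adj) (sg_V G).

Definition sg_edges_in (K : {set sg_vT G}) : {set sg_eT G} :=
  [set e in sg_E G | sg_ends e \subset K].

Definition sg_F (K : {set sg_vT G}) : 'F_2 :=
  \sum_(e in sg_E1 G :&: sg_edges_in K) sg_f e.

(* A direction around a circle K traverses every edge of K towards one of     *)
(* its endpoints, in such a way that no vertex is entered twice. sg_D only     *)
(* matters for circles; there it does not depend on the direction picked.     *)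
Definition sg_direction (K : {set sg_vT G}) (h : {ffun sg_eT G -> sg_vT G}) :
    bool :=
  [forall e in sg_edges_in K, h e \in sg_ends e] &&
  dinjectiveb h (mem (sg_edges_in K)).

Definition sg_D (K : {set sg_vT G}) : 'F_2 :=
  if [pick h | sg_direction K h] is Some h then
    #|[set e in sg_E2 G :&: sg_edges_in K | sg_head e == Some (h e)]|%:R
  else 0.

End SpecialGraph.

Section BoundaryMatching.
Variables (X : framed_flow1cat) (k : int) (phi : cochain X k).
Notation Ob := (fc_ob X).
Notation pt := (fc_pt X).
Notation cmp := (fc_cmp X).

Definition mod0_phi (b : Ob) : {set pt} :=
  \bigcup_(c in rep_obs phi) mod0 b c.

(* The pairs of all the M(b_i, phi) (= mod0_phi b_i), collected in one set. *)
Record boundary_matching := BoundaryMatching {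
  bm_pairs : {set pt * pt};
  bm_pairsP : forall B1 B2, (B1, B2) \in bm_pairs ->
    B1 != B2 /\ exists b, B1 \in mod0_phi b /\ B2 \in mod0_phi b;
  bm_partition : forall b B, B \in mod0_phi b ->
    #|[set p in bm_pairs | (B == p.1) || (B == p.2)]| = 1%N
}.

Variables (C : boundary_matching) (a : Ob).

(* An edge of Gamma_C(a, phi) is inl J for an interval J of some M(a, c_j),   *)
(* or inr ((B1, B2), A), joining (B1, A) to (B2, A).                          *)
Definition gm_edge : finType := (cmp + (pt * pt) * pt)%type.

(* Since the sets M(b, c_j) are disjoint subsets of pt, so are the vertex     *)
(* sets of the graphs Gamma(a, c_j).                                          *)
Definition gm_V : {set pt * pt} :=
  \bigcup_(c in rep_obs phi) \bigcup_(b : Ob) setX (mod0 b c) (mod0 a b).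

Definition gm_E1 : {set gm_edge} :=
  [set inl J | J in \bigcup_(c in rep_obs phi) mod1 a c & is_interval J].

Definition gm_Ematch : {set gm_edge} :=
  [set inr e | e : (pt * pt) * pt &
    [&& e.1 \in bm_pairs C, fc_psrc e.2 == a
      & fc_psrc e.1.1 == fc_ptgt e.2]].

Definition gm_E : {set gm_edge} := gm_E1 :|: gm_Ematch.

Definition gm_E2 : {set gm_edge} :=
  [set e in gm_Ematch |
    if e is inr ((B1, B2), _) then ffc_s B1 == ffc_s B2 else false].

Definition gm_L : {set cmp} :=
  [set S in \bigcup_(c in rep_obs phi) mod1 a c |
    is_circle S && (ffc_f S == 1)].

Definition gm_ends (e : gm_edge) : {set pt * pt} :=
  match e with
  | inl J => fc_bd J
  | inr ((B1, B2), A) => [set (B1, A); (B2, A)]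
  end.

Definition gm_head (e : gm_edge) : option (pt * pt) :=
  if e is inr ((_, B2), A) then Some (B2, A) else None.

Definition gm_s (v : pt * pt) : 'F_2 := ffc_s v.1 + ffc_s v.2.

Definition gm_f (e : gm_edge) : 'F_2 := if e is inl J then ffc_f J else 0.

Lemma mem_mod0_phi b B :
  (B \in mod0_phi b) = (fc_ptgt B \in rep_obs phi) && (fc_psrc B == b).
Proof.
apply/bigcupP/andP=> [[c cphi] | [cphi /eqP <-]].
  by rewrite inE => /andP[-> /eqP->].
by exists (fc_ptgt B); rewrite ?inE ?eqxx.
Qed.

Lemma mem_gm_V v : (v \in gm_V) =
  [&& fc_ptgt v.1 \in rep_obs phi, fc_psrc v.1 == fc_ptgt v.2
    & fc_psrc v.2 == a].
Proof.
apply/bigcupP/and3P=> [[c cphi /bigcupP[b _]] | [cphi /eqP vB /eqP <-]].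
  rewrite !inE => /andP[/andP[/eqP-> /eqP->] /andP[/eqP-> /eqP->]].
  by rewrite cphi !eqxx.
exists (fc_ptgt v.1) => //; apply/bigcupP; exists (fc_ptgt v.2) => //.
by rewrite !inE vB !eqxx.
Qed.

Lemma gm_E1P I : (inl I \in gm_E1) =
  [&& fc_ctgt I \in rep_obs phi, fc_csrc I == a & is_interval I].
Proof.
rewrite mem_imset => [|x y []//]; rewrite inE andbA; congr (_ && _).
apply/bigcupP/andP=> [[c cphi] | [cphi /eqP <-]].
  by rewrite inE => /andP[-> /eqP->].
by exists (fc_ctgt I); rewrite ?inE ?eqxx.
Qed.

Lemma gm_E1_inr e : (inr e \in gm_E1) = false.
Proof. by apply/negP=> /imsetP[]. Qed.

Lemma gm_Ematch_inl I : (inl I \in gm_Ematch) = false.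
Proof. by apply/negP=> /imsetP[]. Qed.

Lemma gm_EmatchP B1 B2 A : (inr ((B1, B2), A) \in gm_Ematch) =
  [&& (B1, B2) \in bm_pairs C, fc_psrc A == a & fc_psrc B1 == fc_ptgt A].
Proof. by rewrite mem_imset => [|x y []//]; rewrite inE. Qed.

Lemma gm_E1_dis e : e \in gm_E1 -> (e \in gm_Ematch) = false.
Proof. by case/imsetP=> J _ ->; rewrite gm_Ematch_inl. Qed.

Lemma gm_EDE1 : gm_E :\: gm_E1 = gm_Ematch.
Proof.
apply/setP=> e; rewrite in_setD in_setU.
by case: (boolP (e \in gm_E1)) => //= /gm_E1_dis->.
Qed.

Lemma gm_bdV J v : inl J \in gm_E1 -> v \in fc_bd J -> v \in gm_V.
Proof.
case: v => B A; rewrite gm_E1P => /and3P[cphi /eqP src _].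
by move=> /fc_bdP[ct st eqs]; rewrite mem_gm_V /= ct cphi st eqs src !eqxx.
Qed.

Lemma bm_pairs_phi B1 B2 : (B1, B2) \in bm_pairs C ->
  [/\ B1 != B2, fc_ptgt B1 \in rep_obs phi, fc_ptgt B2 \in rep_obs phi
    & fc_psrc B1 = fc_psrc B2].
Proof.
case/bm_pairsP=> neqB [b]; rewrite !mem_mod0_phi.
by case=> /andP[-> /eqP->] /andP[-> /eqP->].
Qed.

Fact gm_endsP e : e \in gm_E ->
  gm_ends e \subset gm_V /\ #|gm_ends e| = 2%N.
Proof.
case: e => [J|[[B1 B2] A]].
  rewrite in_setU gm_Ematch_inl orbF => E1J; split; last first.
    by move: E1J; rewrite gm_E1P => /and3P[_ _ /eqP].
  by apply/subsetP=> v; apply: gm_bdV.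
rewrite in_setU gm_E1_inr gm_EmatchP /= => /and3P[/bm_pairs_phi].
case=> neqB c1 c2 eqB /eqP sA /eqP sB; split.
  by apply/subsetP=> v /set2P[]->; rewrite mem_gm_V /= ?c1 ?c2 -?eqB sB sA !eqxx.
by rewrite cards2 xpair_eqE negb_and neqB.
Qed.

Fact gm_E1_sub : gm_E1 \subset gm_E. Proof. exact: subsetUl. Qed.

Fact gm_E2_sub : gm_E2 \subset gm_E :\: gm_E1.
Proof. by rewrite gm_EDE1; apply/subsetP=> e; rewrite inE => /andP[]. Qed.

Fact gm_headP e : e \in gm_E2 ->
  exists2 v, gm_head e = Some v & v \in gm_ends e.
Proof.
case: e => [J|[[B1 B2] A] _]; first by rewrite inE gm_Ematch_inl.
by exists (B2, A); rewrite ?set22.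
Qed.

Lemma gm_degE1 v : v \in gm_V -> #|[set e in gm_E1 | v \in gm_ends e]| = 1%N.
Proof.
case: v => B A; rewrite mem_gm_V /= => /and3P[cphi /eqP sB /eqP sA].
rewrite -(fc_bd_partition sB) -(card_imset _ (@inl_inj cmp ((pt * pt) * pt)%type)).
apply: eq_card => -[J|e]; last first.
  by rewrite inE gm_E1_inr; apply/esym/negP=> /imsetP[].
rewrite mem_imset; last exact: inl_inj.
rewrite !inE gm_E1P /=; case: (boolP (_ \in fc_bd J)) => [|_]; last by rewrite andbF.
move=> JBA; case: (fc_bdP JBA) => <- _ <-; rewrite cphi sA eqxx /= andbT.
rewrite /is_interval; case: (fc_bd_card J) => [/eqP|->//].
by rewrite cards_eq0 => /eqP J0; rewrite J0 inE in JBA.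
Qed.

Lemma gm_degE2 v :
  v \in gm_V -> #|[set e in gm_Ematch | v \in gm_ends e]| = 1%N.
Proof.
case: v => B A; rewrite mem_gm_V /= => /and3P[cphi /eqP sB /eqP sA].
have MB : B \in mod0_phi (fc_psrc B) by rewrite mem_mod0_phi cphi eqxx.
have inj_e : injective (fun p : pt * pt => inr (p, A) : gm_edge).
  by move=> p q [].
rewrite -(bm_partition C MB) -(card_imset _ inj_e).
apply: eq_card => -[J|[[B1 B2] A']].
  by rewrite inE gm_Ematch_inl; apply/esym/negP=> /imsetP[].
rewrite inE gm_EmatchP /= in_set2 !xpair_eqE -andb_orl.
have [eqA|neqA] := eqVneq A A'; last first.
  rewrite !andbF; apply/esym/negP=> /imsetP[p _ [_ eqA]].
  by rewrite eqA eqxx in neqA.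
rewrite -eqA (mem_imset _ (B1, B2) inj_e) inE /= sA eqxx andbT /=.
case: (boolP ((B1, B2) \in _)) => //= /bm_pairs_phi[_ _ _ eqB].
have [eqB1|_] := eqVneq B B1; first by rewrite -eqB1 sB eqxx.
by have [eqB2|_] := eqVneq B B2; rewrite ?andbF //= eqB -eqB2 sB eqxx.
Qed.

Lemma gm_deg v : v \in gm_V -> #|[set e in gm_E | v \in gm_ends e]| = 2%N.
Proof.
move=> Vv; rewrite -[2%N]/(1 + 1)%N -{1}(gm_degE1 Vv) -(gm_degE2 Vv).
rewrite -cardsUI; set I12 := _ :&: _.
have -> : I12 = set0.
  apply/setP=> e; rewrite in_setI 2!in_set in_set0.
  by case: (boolP (e \in gm_E1)) => //= /gm_E1_dis->; rewrite andbF.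
by rewrite cards0 addn0; apply: eq_card => e; rewrite !inE andb_orl.
Qed.

Fact gm_deg1or2 v : v \in gm_V ->
  (1 <= #|[set e in gm_E | v \in gm_ends e]| <= 2)%N.
Proof. by move/gm_deg->. Qed.

Fact gm_boundaryP v e :
    v \in [set v in gm_V | #|[set e in gm_E | v \in gm_ends e]| == 1%N] ->
  e \in gm_E -> v \in gm_ends e -> e \in gm_E1.
Proof. by rewrite inE => /andP[/gm_deg->]. Qed.

Fact gm_interiorP v :
    v \in gm_V :\:
      [set v in gm_V | #|[set e in gm_E | v \in gm_ends e]| == 1%N] ->
  #|[set e in gm_E1 | v \in gm_ends e]| = 1%N /\
  #|[set e in gm_E :\: gm_E1 | v \in gm_ends e]| = 1%N.
Proof.
by rewrite inE gm_EDE1 => /andP[_ Vv]; rewrite gm_degE1 ?gm_degE2.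
Qed.

Fact gm_signE1 e v w : e \in gm_E1 -> gm_ends e = [set v; w] -> v != w ->
  gm_s v != gm_s w.
Proof.
case: e v w => [J|e] [P1 Q1] [P2 Q2]; last by rewrite gm_E1_inr.
move=> _ /= bdJ neq; have := ffc_signP neq bdJ; rewrite /gm_s /= -addrA.
by apply: contra_eq_neq => ->; rewrite -mulr2n -mulr_natl pchar_Zp ?mul0r.
Qed.

Fact gm_signE2 e v w : e \in gm_E :\: gm_E1 -> gm_ends e = [set v; w] ->
  v != w -> (gm_s v == gm_s w) = (e \in gm_E2).
Proof.
rewrite gm_EDE1; case: e => [J|[[B1 B2] A]]; first by rewrite gm_Ematch_inl.
move=> Ee /= eqVW neq; rewrite inE Ee /=.
have /set2P v12 : v \in [set (B1, A); (B2, A)] by rewrite eqVW set21.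
have /set2P w12 : w \in [set (B1, A); (B2, A)] by rewrite eqVW set22.
by case: v12 w12 neq => -> [] ->; rewrite ?eqxx // => _;
  rewrite /gm_s /= (inj_eq (addIr _)) // eq_sym.
Qed.

(* Gamma_C(a, phi) *)
Definition matched_graph : special_graph :=
  SpecialGraph gm_L gm_f gm_endsP gm_E1_sub gm_E2_sub gm_headP gm_deg1or2
    gm_boundaryP gm_interiorP gm_signE1 gm_signE2.

End BoundaryMatching.

Definition sq (X : framed_flow1cat) (k : int) (phi : cochain X k)
    (C : boundary_matching phi) : cochain X (k + 2) :=
  [ffun a => let G := matched_graph C (val a) in
    #|sg_L G|%:R + \sum_(K in sg_components G) (1 + sg_F K + sg_D K)].

(* Main.v *)
From HB Require Import structures.
Require Import Defs.
From mathcomp Require Import all_boot all_order all_algebra all_fingroup.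

Set Implicit Arguments.
Unset Strict Implicit.
Unset Printing Implicit Defensive.

Import GRing.Theory.
Local Open Scope ring_scope.

(** Counting the circles of a graph modulo 2 is turned into computing a sign.

    Two perfect matchings of a finite set, with ordered edges, have a relative
    sign: the parity of any permutation carrying the first matching to the
    second.  It is well defined because a permutation preserving an ordered
    matching acts in the same way on the first and on the last end points, so
    it is even.  When every point comes first in one of its two edges and last
    in the other, such a permutation is obtained by walking one step along the
    union of the matchings, and the sign is the number of circles
    ([rel_sign_alternating]).  Relative signs are additive along a chain of
    matchings ([rel_sign_trans]) and over disjoint unions
    ([rel_sign_fibres]), they change in a controlled way when edges are
    reversed ([rel_sign_relead]), and they are explicit when the matchings
    commute, all circles then having length four ([rel_sign_commuting]).

    The vertices of Gamma_C(a, phi) carry two matchings, by the intervals of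
    the M(a, c_j) and by C.  Order an interval from sign 0 to sign 1 and a pair
    of C as it is given.  Then sq^phi(a) is the sum of all framing values in
    the M(a, c_j), plus the relative sign of the two matchings, plus the sum of
    the signs of the last vertices of the pairs ([sq_rel_sign]); the last
    summand is what the directions of the edges contribute.  In the same way,
    the corners of the boundary of M(a, d), which are triples of points, carry
    two matchings whose unions are the boundary circles, and the compatibility
    condition says what their relative sign is ([compatibility_rel_sign]).

    Cocycle condition.  The sum of the sq^phi over the faces of degree k + 2 of
    d is the relative sign, on the triples in the M(d, c_j), of the intervals
    I x {A} against C.  Take the intervals {P} x J as an intermediate matching:
    the compatibility condition gives the sign of the first step, the second
    step has circles of length four only, and everything cancels
    ([sq_at_cocycle]).

    Dependence on choices.  The formula for sq^phi makes sense for every finite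
    family of objects, with repetitions, and every matching C of the points
    that end in its members.  In the difference of the cochains of two
    matchings the intervals disappear, and what is left is a sum over the
    points A of M(a, b) of a quantity that depends on b only: a coboundary
    ([fam_sq_matching]).  If every object occurs an even number of times, equal
    objects can be paired, which gives the zero cochain; so every matching then
    gives a coboundary ([fam_sq_coboundary]).  For the family of the sources of
    all points ending in the objects of a cochain theta, which represents
    delta theta with multiplicities, the intervals of the M(b, c) provide a
    matching, and the compatibility condition shows that its cochain is a
    coboundary as well ([delta_sq_coboundary]).  If phi + psi + chi is
    delta theta, every object occurs an even number of times in the union of
    the four families, so sq^phi + sq^psi + sq^chi is a coboundary
    ([sq_triple]).  Independence of C, invariance under phi + delta theta and
    additivity are all instances of this. *)

(** * Arithmetic modulo 2 *)


Local Notation "b %:F" := ((nat_of_bool b)%:R : 'F_2).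

Lemma F2P (x : 'F_2) : x = 0 \/ x = 1.
Proof. by case: x => [[|[|//]] lt]; [left|right]; apply/val_inj. Qed.

Lemma addF2 (x : 'F_2) : x + x = 0.
Proof. by case: (F2P x) => ->; apply/eqP. Qed.

Lemma addF2_eq0 (x y : 'F_2) : x + y = 0 -> x = y.
Proof. by case: (F2P x) => ->; case: (F2P y) => -> // /eqP. Qed.

Lemma eq0F2 (x : 'F_2) : (x == 0)%:F = 1 + x.
Proof. by case: (F2P x) => ->; apply/eqP. Qed.

Lemma eq1F2 (x : 'F_2) : (x == 1)%:F = x.
Proof. by case: (F2P x) => ->; apply/eqP. Qed.

Lemma F2_eq0_flip (x : 'F_2) : (x + 1 == 0) = ~~ (x == 0).
Proof. by case: (F2P x) => ->. Qed.

Lemma F2_eq1_flip (x : 'F_2) : (x + 1 == 1) = ~~ (x == 1).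
Proof. by case: (F2P x) => ->. Qed.

Lemma negbF2 b : (~~ b)%:F = 1 + b%:F.
Proof. by case: b; apply/eqP. Qed.

Lemma addbF2 a b : (a (+) b)%:F = a%:F + b%:F.
Proof. by case: a; case: b; apply/eqP. Qed.

Lemma andbF2 a b : (a && b)%:F = a%:F * b%:F.
Proof. by case: a; case: b; apply/eqP. Qed.

Lemma oddF2 n : (odd n)%:F = n%:R.
Proof. by elim: n => //= n ih; rewrite negbF2 ih -natr1 addrC. Qed.

Lemma cardF2 (T : finType) (V : {set T}) (P : pred T) :
  #|[set v in V | P v]|%:R = \sum_(v in V) (P v)%:F.
Proof.
rewrite -sum1_card natr_sum (eq_bigl (fun v => (v \in V) && P v)); last first.
  by move=> v; rewrite inE.
by rewrite big_mkcondr; apply: eq_bigr => v _; case: (P v).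
Qed.

(** * Ordered perfect matchings *)

(** [mate] exchanges the end points of an edge and [lead] tells which of them
    comes first. Both are total, so that one pair of functions can be used on
    many vertex sets; only their values on the vertex set matter. *)
Record matching (T : Type) := Matching { mate : T -> T; lead : T -> bool }.

Definition matches (T : finType) (V : {set T}) (M : matching T) :=
  forall v, v \in V ->
    [/\ mate M v \in V, mate M (mate M v) = v
      & lead M (mate M v) = ~~ lead M v].

Section Matchings.
Variables (T : finType) (V : {set T}).
Implicit Types (M N : matching T) (p q : {perm T}) (v w : T).

Lemma mate_in M v : matches V M -> v \in V -> mate M v \in V.
Proof. by move=> mM /mM[]. Qed.

Lemma mateK M v : matches V M -> v \in V -> mate M (mate M v) = v.
Proof. by move=> mM /mM[]. Qed.

Lemma lead_mate M v : matches V M -> v \in V -> lead M (mate M v) = ~~ lead M v.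
Proof. by move=> mM /mM[]. Qed.

Lemma mate_neq M v : matches V M -> v \in V -> mate M v != v.
Proof.
move=> mM Vv; apply/eqP=> e; have := lead_mate mM Vv.
by rewrite e; case: (lead M v).
Qed.

Lemma reindex_mate M (R : Type) (idx : R) (op : Monoid.com_law idx)
    (P : pred T) (G : T -> R) : matches V M ->
  \big[op/idx]_(v in V | P v) G v =
  \big[op/idx]_(v in V | P (mate M v)) G (mate M v).
Proof.
move=> mM; rewrite (reindex_onto (mate M) (mate M)); last first.
  by move=> v /andP[Vv _]; rewrite mateK.
apply: eq_bigl => v; case: (boolP (v \in V)) => Vv.
  by rewrite mate_in // mateK // eqxx andbT.
apply/negP=> /andP[/andP[Vm _] /eqP e]; case/negP: Vv.
by rewrite -e mate_in.
Qed.

Lemma sum_mate0 M (G : T -> 'F_2) : matches V M ->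
  {in V, forall v, G (mate M v) = G v} -> \sum_(v in V) G v = 0.
Proof.
move=> mM inv; rewrite (bigID (lead M)) /=.
rewrite [X in _ + X](reindex_mate _ _ _ mM).
rewrite [X in _ + X](eq_big (fun v => (v \in V) && lead M v) G) ?addF2 //.
  by move=> v; case: (boolP (v \in V)) => //= Vv; rewrite lead_mate // negbK.
by move=> v /andP[Vv _]; rewrite inv.
Qed.

Lemma card_lead M (P : pred T) : matches V M ->
    {in V, forall v, P (mate M v) = P v} ->
  #|[set v in V | P v]| = #|[set v in V | lead M v && P v]|.*2.
Proof.
move=> mM inv; rewrite -addnn -!sum1_card.
have E Q : (\sum_(v in [set v in V | Q v]) 1 = \sum_(v in V | Q v) 1)%N.
  by apply: eq_bigl => v; rewrite inE.
rewrite !E (bigID (lead M)) /=; congr (_ + _)%N.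
  by apply: eq_bigl => v; rewrite -andbA [P v && _]andbC.
transitivity (\sum_(v in V | P v && ~~ lead M v) 1)%N.
  by apply: eq_bigl => v; rewrite andbA.
rewrite (reindex_mate _ _ _ mM); apply: eq_bigl => v.
by case: (boolP (v \in V)) => //= Vv; rewrite lead_mate // negbK inv // andbC.
Qed.

(** Both sides are half the number of points where [G] is 1. *)
Lemma sum_lead M N (G : T -> 'F_2) : matches V M -> matches V N ->
    {in V, forall v, G (mate M v) = G v} ->
    {in V, forall v, G (mate N v) = G v} ->
  \sum_(v in V) (lead M v)%:F * G v = \sum_(v in V) (lead N v)%:F * G v.
Proof.
move=> mM mN iM iN.
have E K : \sum_(v in V) (lead K v)%:F * G v =
    #|[set v in V | lead K v && (G v == 1)]|%:R.
  by rewrite cardF2; apply: eq_bigr => v _; rewrite andbF2 eq1F2.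
rewrite !E; congr (_%:R); apply: double_inj.
by rewrite -!card_lead // => v Vv; rewrite ?iM ?iN.
Qed.

(** The permutations of [V], extended by the identity, that carry the ordered
    edges of [M] to those of [N]. *)
Definition aligns M N p := [forall v,
  if v \in V then
    [&& p v \in V, p (mate M v) == mate N (p v) & lead N (p v) == lead M v]
  else p v == v].

Lemma alignsP M N p : reflect
  ((forall v, v \notin V -> p v = v) /\
   (forall v, v \in V -> [/\ p v \in V, p (mate M v) = mate N (p v)
                           & lead N (p v) = lead M v]))
  (aligns M N p).
Proof.
apply: (iffP forallP) => [A | [off on] v].
  split=> v Vv; have := A v; first by rewrite (negbTE Vv) => /eqP.
  by rewrite Vv => /and3P[-> /eqP-> /eqP->].
case: ifPn => [/on[-> -> ->]|/off->]; by rewrite ?eqxx.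
Qed.

Lemma aligns_in M N p v : aligns M N p -> (p v \in V) = (v \in V).
Proof.
case/alignsP=> off on; case: (boolP (v \in V)) => [/on[]//|nV].
by rewrite off // (negbTE nV).
Qed.

Lemma aligns_comp L M N p q :
  aligns L M p -> aligns M N q -> aligns L N (p * q)%g.
Proof.
case/alignsP=> off on /alignsP[off' on']; apply/alignsP; split=> v Vv.
  by rewrite permM off // off'.
case: (on v Vv) => Vp e1 e2; case: (on' _ Vp) => Vq e3 e4.
by rewrite !permM e1 e3 e4 e2.
Qed.

Lemma aligns_inv M N p : matches V M -> aligns M N p -> aligns N M p^-1%g.
Proof.
move=> mM A; have [off on] := alignsP _ _ _ A; apply/alignsP; split=> v Vv.
  by apply: (perm_inj (s := p)); rewrite permKV off.
have Vp : p^-1%g v \in V by rewrite -(aligns_in _ A) permKV.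
have [_ e1 e2] := on _ Vp; split=> //; last by rewrite -e2 permKV.
by apply: (perm_inj (s := p)); rewrite e1 !permKV.
Qed.

(** Conjugation by [mate M] turns the action of [p] on the first end points
    into its action on the last ones, so [p] is a product of two permutations
    of the same parity. *)
Lemma aligns_even M p : matches V M -> aligns M M p -> odd_perm p = false.
Proof.
move=> mM A; have [off on] := alignsP _ _ _ A.
pose mf v := if v \in V then mate M v else v.
have mfK : involutive mf.
  move=> v; rewrite /mf; case: (boolP (v \in V)) => Vv.
    by rewrite mate_in // mateK.
  by rewrite (negbTE Vv).
pose pf v := if (v \in V) && lead M v then p v else v.
have pf_inj : injective pf.
  move=> v w; rewrite /pf; case: ifPn => Lv; case: ifPn => Lw //.
  - exact: perm_inj.
  - case/andP: Lv => Vv Lv e; case/negP: Lw; rewrite -e.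
    by have [-> _ ->] := on v Vv.
  - case/andP: Lw => Vw Lw e; case/negP: Lv; rewrite e.
    by have [-> _ ->] := on w Vw.
pose m := perm (inv_inj mfK); pose p1 := perm pf_inj.
suff -> : p = (p1 * (m * p1 * m))%g.
  by rewrite !odd_permM; do 2 case: (odd_perm _).
apply/permP=> v; rewrite !permM !permE /pf /mf.
have [Vv|nVv] /= := boolP (v \in V); last by rewrite !(negbTE nVv) /= off.
have [Vp e1 e2] := on v Vv; case: (boolP (lead M v)) => Lv.
  by rewrite Vp mate_in //= lead_mate // e2 Lv /= mate_in // mateK.
by rewrite Vv mate_in //= lead_mate // Lv e1 mate_in // mateK.
Qed.

Lemma aligns_odd M N p q : matches V M ->
  aligns M N p -> aligns M N q -> odd_perm p = odd_perm q.
Proof.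
move=> mM Ap Aq; have := aligns_even mM (aligns_comp Ap (aligns_inv mM Aq)).
by rewrite odd_permM odd_permV; do 2 case: (odd_perm _).
Qed.

(** The relative sign of the terms of a Pfaffian given by two ordered
    matchings. *)
Definition rel_sign M N : 'F_2 :=
  if [pick p | aligns M N p] is Some p then (odd_perm p)%:F else 0.

Lemma rel_signE M N p : matches V M -> aligns M N p ->
  rel_sign M N = (odd_perm p)%:F.
Proof.
move=> mM A; rewrite /rel_sign; case: pickP => [q Aq|/(_ p)]; last by rewrite A.
by rewrite (aligns_odd mM Aq A).
Qed.

End Matchings.

(** An involution is a product of disjoint transpositions, and [D] contains one
    point of each. *)
Lemma odd_involution (T : finType) (p : {perm T}) (D : {set T}) :
    (forall v, p (p v) = v) ->
    (forall v, p v != v -> (p v \in D) = (v \notin D)) ->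
    (forall v, v \in D -> p v != v) ->
  odd_perm p = odd #|D|.
Proof.
have [n] := ubnP #|D|; elim: n p D => // n IHn p D leDn pK altD movD.
have [D0|[x Dx]] := set_0Vmem D.
  suff -> : p = 1%g by rewrite D0 cards0 odd_perm1.
  apply/permP=> v; rewrite perm1; apply/eqP/idPn=> nv.
  by have := altD v nv; rewrite D0 !inE.
pose q := (tperm x (p x) * p)%g.
have nx := movD x Dx.
have qE v : q v = if (v == x) || (v == p x) then v else p v.
  rewrite permM; case: tpermP => [->|->|/eqP/negbTE-> /eqP/negbTE->] //.
    by rewrite eqxx pK.
  by rewrite eqxx orbT.
have npx v : v != x -> v != p x -> (p v != x) && (p v != p x).
  move=> n1 n2; rewrite (inj_eq perm_inj) n1 andbT.
  by apply: contra n2 => /eqP<-; rewrite pK.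
have -> : p = (tperm x (p x) * q)%g by rewrite /q mulgA tperm2 mul1g.
rewrite odd_mul_tperm eq_sym nx (IHn q (D :\ x)).
- by rewrite [in RHS](cardsD1 x) Dx.
- by rewrite (cardsD1 x) Dx in leDn.
- move=> v; rewrite !qE; case: (boolP ((v == x) || (v == p x))) => [->//|].
  rewrite negb_or => /andP[n1 n2].
  by have /andP[/negbTE-> /negbTE->] := npx v n1 n2; rewrite pK.
- move=> v; rewrite !qE; case: ifPn => [|]; first by rewrite eqxx.
  rewrite negb_or => /andP[n1 n2] mv; have /andP[n3 _] := npx v n1 n2.
  by rewrite !inE n3 n1 altD.
- move=> v; rewrite !inE qE => /andP[n1 Dv]; have mv := movD v Dv.
  rewrite (negbTE n1) /=; case: ifPn => // /eqP e.
  by have := altD x nx; rewrite -e Dv Dx.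
Qed.

Lemma sum_edges (T : finType) (V : {set T}) (M : matching T) (G : T -> 'F_2) :
    matches V M ->
  \sum_(v in V) G v = \sum_(v in V) (~~ lead M v)%:F * (G v + G (mate M v)).
Proof.
move=> mM; under [RHS]eq_bigr do rewrite mulrDr.
rewrite big_split /= [X in _ + X](_ : _ = \sum_(v in V) (lead M v)%:F * G v).
  rewrite -big_split; apply: eq_bigr => v _ /=.
  by case: (lead M v); rewrite mul1r mul0r ?addr0 ?add0r.
have := reindex_mate +%R predT (fun v => (lead M v)%:F * G v) mM.
rewrite /= (eq_bigl (mem V)) => [->|v]; last by rewrite andbT.
apply: eq_big => [v|v Vv]; first by rewrite andbT.
by rewrite (lead_mate mM).
Qed.

(** * The relative sign of two matchings *)

Definition relead (T : Type) (M : matching T) h := Matching (mate M) h.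

Section RelativeSign.
Variables (T : finType) (V : {set T}).
Implicit Types (M N : matching T) (p q : {perm T}) (v w : T).

Lemma matches_relead M h : matches V M ->
  {in V, forall v, h (mate M v) = ~~ h v} -> matches V (relead M h).
Proof. by move=> mM hM v Vv; have [? ? _] := mM v Vv; split=> //; apply: hM. Qed.

(** Exchanging the end points of the edges whose order changes is a product of
    as many disjoint transpositions. *)
Lemma relead_aligns M h : matches V M -> matches V (relead M h) ->
  exists2 p, aligns V M (relead M h) p &
    (odd_perm p)%:F = \sum_(v in V) (lead M v)%:F * (~~ h v)%:F.
Proof.
move=> mM mN.
pose f v := if (v \in V) && (lead M v != h v) then mate M v else v.
have hm v : v \in V -> h (mate M v) = ~~ h v by move/mN=> [].
have fK : involutive f.
  move=> v; rewrite /f; case: (boolP (v \in V)) => Vv /=; last first.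
    by rewrite (negbTE Vv).
  case: (boolP (lead M v != h v)) => d; last by rewrite Vv (negbTE d).
  by rewrite mate_in // (lead_mate mM) // hm // (mateK mM) // (inj_eq negb_inj) d.
pose p := perm (inv_inj fK).
exists p; last first.
  rewrite (odd_involution (D := [set v in V | lead M v && ~~ h v])).
  - by rewrite oddF2 cardF2; apply: eq_bigr => v _; rewrite andbF2.
  - by move=> v; rewrite !permE fK.
  - move=> v; rewrite permE /f; case: (boolP (v \in V)) => Vv /=; rewrite ?eqxx //.
    case: (boolP (lead M v != h v)); rewrite ?eqxx // => d _.
    rewrite !inE mate_in // (lead_mate mM) // hm // Vv /=; move: d.
    by case: (lead M v); case: (h v).
  - move=> v; rewrite inE permE /f => /and3P[Vv -> /negbTE->].
    by rewrite Vv (mate_neq mM).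
apply/alignsP; split=> v Vv; rewrite !permE /f ?Vv //; first by rewrite (negbTE Vv).
rewrite mate_in //= (lead_mate mM) // hm // (inj_eq negb_inj).
case: ifPn => d; first by rewrite mate_in // hm // (mateK mM) //; split=> //;
  case: (lead M v) d; case: (h v).
by split=> //; move: d; rewrite negbK => /eqP.
Qed.


(** One step along the union of the two matchings. If the orders alternate,
    every circle is followed in one direction. *)
Definition walk M N v := if v \in V then
  if lead M v then mate M v else mate N v else v.

Section Alternating.
Variables (M N : matching T).
Hypotheses (mM : matches V M) (mN : matches V N).
Hypothesis alt : {in V, forall v, lead N v = ~~ lead M v}.

Lemma lead_alt_mate v : v \in V -> lead M (mate N v) = ~~ lead M v.
Proof.
by move=> Vv; apply: negb_inj; rewrite -!alt ?mate_in // (lead_mate mN).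
Qed.

Lemma walk_inj : injective (walk M N).
Proof.
apply: (@can_inj _ _ _ (fun v => if v \in V then
  if lead M v then mate N v else mate M v else v)) => v; rewrite /walk.
case: (boolP (v \in V)) => Vv; last by rewrite (negbTE Vv).
case: (boolP (lead M v)) => L; rewrite mate_in //.
  by rewrite (lead_mate mM) // L (mateK mM).
by rewrite lead_alt_mate // L (mateK mN).
Qed.

Definition walk_perm := perm walk_inj.

Lemma walk_aligns : aligns V M N walk_perm.
Proof.
apply/alignsP; split=> v Vv; rewrite !permE /walk ?Vv ?(negbTE Vv) //.
rewrite (mate_in mM) // (lead_mate mM) // (mateK mM) //.
case: (boolP (lead M v)) => L /=.
  by rewrite alt ?mate_in // (lead_mate mM) // L.
by rewrite mate_in // (mateK mN) // alt ?mate_in // lead_alt_mate // L.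
Qed.

Let step : rel T := [rel v w | (w == mate M v) || (w == mate N v)].

Lemma porbit_step v w : v \in V -> connect step v w -> w \in porbit walk_perm v.
Proof.
move=> Vv /connectP[s]; elim: s v Vv => [|u s IHs] v Vv /= => [_ ->|].
  exact: porbit_id.
case/andP=> vu path_s last_w.
have Vu : u \in V by case/orP: vu => /eqP->; rewrite mate_in.
have := IHs u Vu path_s last_w; rewrite -!eq_porbit_mem => /eqP->.
rewrite eq_porbit_mem.
have uE : walk_perm v = u \/ walk_perm u = v.
  rewrite !permE /walk Vu Vv.
  case/orP: vu => /eqP->; [case: (boolP (lead M v)) => L|case: (boolP (lead M v)) => L].
  - by left.
  - by right; rewrite (lead_mate mM) // L (mateK mM).
  - by right; rewrite lead_alt_mate // L (mateK mN).
  - by left.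
have next x : walk_perm x \in porbit walk_perm x.
  by have := mem_porbit walk_perm 1 x; rewrite expg1.
by case: uE => <-; rewrite // porbit_sym.
Qed.

(** [walk_perm] carries [M] to [N] and its cycles in [V] are the classes of
    [F]. The number of points of [V] is even, so the parity of [walk_perm] is
    that of its number of cycles in [V]. *)
Lemma rel_sign_alternating (S : finType) (F : T -> S) :
    {in V, forall v, F (mate M v) = F v} ->
    {in V, forall v, F (mate N v) = F v} ->
    {in V &, forall v w, F v = F w -> connect step v w} ->
  rel_sign V M N = #|F @: V|%:R.
Proof.
move=> FM FN Fc; rewrite (rel_signE mM walk_aligns) /odd_perm.
pose p := walk_perm.
have pV v : (p v \in V) = (v \in V) by rewrite (aligns_in v walk_aligns).
have porbV v w : v \in V -> w \in porbit p v -> w \in V /\ F w = F v.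
  move=> Vv /porbitP[i ->]; elim: i => [|i [Vi Fi]]; first by rewrite expg0 perm1.
  rewrite expgSr permM pV Vi permE /walk Vi; split=> //.
  by case: ifP => _; rewrite ?FM ?FN.
have porb1 v : v \notin V -> porbit p v = [set v].
  move=> nV; apply/setP=> w; rewrite inE; apply/porbitP/eqP => [[i ->]|->].
    elim: i => [|i IHi]; first by rewrite expg0 perm1.
    by rewrite expgSr permM IHi permE /walk (negbTE nV).
  by exists 0%N; rewrite expg0 perm1.
have -> : porbits p = (porbit p @: V) :|: (porbit p @: ~: V).
  rewrite -imsetU setUCr; apply/setP=> A.
  by apply/imsetP/imsetP => -[v _ ->]; exists v.
have -> : #|porbit p @: V :|: porbit p @: ~: V| = (#|F @: V| + #|~: V|)%N.
  rewrite cardsU (_ : _ :&: _ = set0) ?cards0 ?subn0; last first.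
    apply/setP=> A; rewrite !inE; apply/negP=> /andP[/imsetP[v Vv ->]].
    case/imsetP=> w; rewrite inE => nVw /eqP; rewrite eq_sym eq_porbit_mem.
    by case/porbV => //; rewrite (negbTE nVw).
  congr (_ + _)%N; last first.
    apply: card_in_imset => v w; rewrite !inE => nv nw.
    by rewrite !porb1 // => /set1_inj.
  have FE : {in V &, forall v w, (porbit p v == porbit p w) = (F v == F w)}.
    move=> v w Vv Vw; rewrite eq_porbit_mem; apply/idP/eqP => [/porbV[]//|e].
    by apply: porbit_step => //; apply: Fc.
  pose G (A : {set T}) := if [pick v in V | porbit p v == A] is Some v then
    Some (F v) else None.
  rewrite -(card_in_imset (f := G) (D := porbit p @: V)).
    rewrite -(card_imset (F @: V) Some_inj) -!imset_comp.
    congr #|pred_of_set _|; apply: eq_in_imset => v Vv /=.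
    rewrite /G; case: pickP => [w /andP[Vw]|/(_ v)]; last by rewrite Vv eqxx.
    by rewrite FE // => /eqP->.
  move=> A B /imsetP[v Vv ->] /imsetP[w Vw ->]; rewrite /G.
  case: pickP => [v' /andP[Vv']|/(_ v)]; last by rewrite Vv eqxx.
  rewrite FE // => /eqP->.
  case: pickP => [w' /andP[Vw']|/(_ w)]; last by rewrite Vw eqxx.
  by rewrite FE // => /eqP-> [/eqP]; rewrite -FE // => /eqP.
have -> : #|T| = (#|[set v in V | lead M v && predT v]|.*2 + #|~: V|)%N.
  rewrite -card_lead // -(cardsC V); congr (_ + _)%N.
  by apply: eq_card => v; rewrite inE andbT.
rewrite !oddD odd_double /= -[odd #|F @: V|%N]/(odd _) addbCA addbb addbF.
by rewrite oddF2.
Qed.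

End Alternating.

(** A union of two perfect matchings is bipartite: on each circle, the product
    of the two involutions has exactly two cycles, and both involutions
    exchange them. *)
Lemma exists_alternating M N : matches V M -> matches V N ->
  exists g : T -> bool,
    {in V, forall v, g (mate M v) = ~~ g v /\ g (mate N v) = ~~ g v}.
Proof.
move=> mM mN.
have ext_inj K : matches V K ->
    injective (fun v => if v \in V then mate K v else v).
  move=> mK; apply: inv_inj => v; case: (boolP (v \in V)) => Vv.
    by rewrite mate_in // (mateK mK).
  by rewrite (negbTE Vv).
pose m := perm (ext_inj M mM); pose n := perm (ext_inj N mN).
have mE v : v \in V -> m v = mate M v by rewrite permE => ->.
have nE v : v \in V -> n v = mate N v by rewrite permE => ->.
have mK v : m (m v) = v.
  rewrite !permE; case: (boolP (v \in V)) => Vv; last by rewrite (negbTE Vv).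
  by rewrite mate_in // (mateK mM).
have nK v : n (n v) = v.
  rewrite !permE; case: (boolP (v \in V)) => Vv; last by rewrite (negbTE Vv).
  by rewrite mate_in // (mateK mN).
pose r := (m * n)%g.
have rV i v : v \in V -> (r ^+ i)%g v \in V.
  move=> Vv; elim: i => [|i IHi]; first by rewrite expg0 perm1.
  by rewrite expgSr !permM mE // nE ?mate_in.
have rm v : (r (m (r v)))%g = m v by rewrite !permM mK nK.
have rmX i v : (r ^+ i)%g (m ((r ^+ i)%g v)) = m v.
  elim: i v => [|i IHi] v; first by rewrite expg0 !perm1.
  by rewrite {2}expgSr permM expgS permM -[r (m _)]/(r (m (r _))) rm IHi.
(* If [m v] were [r ^ i v], the middle of that part of the circle would be a
   point fixed by [m] or by [n]. *)
have ne v : v \in V -> m v \notin porbit r v.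
  move=> Vv; apply/negP=> /porbitP[i mi].
  have [j [b ij]] : exists j, exists b : bool, i = (j + b + j)%N.
    exists i./2, (odd i); rewrite [(_ + odd i)%N]addnC -addnA addnn.
    by rewrite odd_double_half.
  have Vu := rV j v Vv; have := rmX j v; set u := (r ^+ j)%g v in Vu *.
  rewrite mi ij 2!expgD !permM => /perm_inj; rewrite -/u; case: b {ij} => /=.
    rewrite expg1 permM mE // nE ?mate_in // => e.
    by have := mate_neq mN (mate_in mM Vu); rewrite -e eqxx.
  by rewrite expg0 perm1 mE // => e; have := mate_neq mM Vu; rewrite e eqxx.
have me v : v \in V -> porbit r (m v) != porbit r v.
  by move=> Vv; rewrite eq_porbit_mem ne.
(* any strict total order on the cycles colours one of the two in each circle *)
exists (fun v => enum_rank (porbit r v) < enum_rank (porbit r (m v)))%N => v Vv.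
have flip : (enum_rank (porbit r (m v)) < enum_rank (porbit r v))%N =
    ~~ (enum_rank (porbit r v) < enum_rank (porbit r (m v)))%N.
  rewrite -leqNgt ltn_neqAle; case: eqP => // /val_inj/enum_rank_inj e.
  by have := me v Vv; rewrite e eqxx.
rewrite -!mE // -nE // mK.
have next x : r x \in porbit r x by have := mem_porbit r 1 x; rewrite expg1.
have -> : porbit r (n v) = porbit r (m v).
  have := next (m v); rewrite permM mK -eq_porbit_mem => /eqP.
  exact.
have -> : porbit r (m (n v)) = porbit r v.
  have := next (m (n v)); rewrite permM mK nK -eq_porbit_mem => /eqP.
  by move->.
by [].
Qed.

(** Reverse edges of [M] until the orders alternate along the circles, walk one
    step, and reverse edges again. *)
Lemma exists_aligns M N : matches V M -> matches V N ->
  exists p, aligns V M N p.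
Proof.
move=> mM mN; have [g gP] := exists_alternating mM mN.
have mMg : matches V (relead M g) by apply: matches_relead => // v /gP[].
have mNg : matches V (relead N (negb \o g)).
  by apply: matches_relead => // v /gP[_ /=->].
have mNg' : matches V (relead (relead N (negb \o g)) (lead N)) by case: (N) mN.
have alt : {in V, forall v, lead (relead N (negb \o g)) v = ~~ lead (relead M g) v}.
  by [].
have [p Ap _] := relead_aligns mM mMg.
have [q Aq _] := relead_aligns mNg mNg'.
exists (p * (walk_perm mMg mNg alt * q))%g.
apply: aligns_comp Ap _; apply: aligns_comp (walk_aligns _ _ _) _.
by case: (N) Aq.
Qed.

Lemma rel_sign_trans L M N :
    matches V L -> matches V M -> matches V N ->
  rel_sign V L N = rel_sign V L M + rel_sign V M N.
Proof.
move=> mL mM mN; have [p Ap] := exists_aligns mL mM.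
have [q Aq] := exists_aligns mM mN.
rewrite (rel_signE mL (aligns_comp Ap Aq)) (rel_signE mL Ap) (rel_signE mM Aq).
by rewrite odd_permM addbF2.
Qed.

Lemma rel_sign_relead M h : matches V M -> matches V (relead M h) ->
  rel_sign V M (relead M h) = \sum_(v in V) (lead M v)%:F * (~~ h v)%:F.
Proof.
by move=> mM mN; have [p Ap <-] := relead_aligns mM mN; apply: rel_signE Ap.
Qed.

Lemma rel_sign_id M : matches V M -> rel_sign V M M = 0.
Proof.
move=> mM; rewrite (rel_signE (p := 1%g) mM) ?odd_perm1 //.
by apply/alignsP; split=> v Vv; rewrite !perm1 //; split=> //; apply: mate_in.
Qed.

Lemma rel_signC M N : matches V M -> matches V N ->
  rel_sign V M N = rel_sign V N M.
Proof.
move=> mM mN; apply: addF2_eq0.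
by rewrite -rel_sign_trans // rel_sign_id.
Qed.

End RelativeSign.

Section Transport.
Variables (T T' : finType) (i : T -> T') (V : {set T}).
Hypothesis i_inj : injective i.

(** A permutation is a product of transpositions, and each of these can be
    transported. *)
Lemma transport_perm (p : {perm T}) : exists p' : {perm T'},
  [/\ odd_perm p' = odd_perm p, forall v, p' (i v) = i (p v)
    & forall w, w \notin codom i -> p' w = w].
Proof.
have [ts -> _] := prod_tpermP p; elim: ts => [|t ts [q [oq iq nq]]].
  by exists 1%g; split=> [|v|w _]; rewrite ?big_nil ?odd_perm1 ?perm1.
exists (tperm (i t.1) (i t.2) * q)%g; rewrite big_cons; split=> [|v|w nw].
- by rewrite !odd_mul_tperm (inj_eq i_inj) oq.
- by rewrite !permM -(inj_tperm _ _ _ i_inj) iq.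
rewrite permM tpermD ?nq //.
  by apply: contraNneq nw => <-; apply: codom_f.
by apply: contraNneq nw => <-; apply: codom_f.
Qed.

Variables (M N : matching T) (M' N' : matching T').
Hypotheses (mM : matches V M) (mN : matches V N).

Definition transports (K : matching T) (K' : matching T') := {in V, forall v,
  mate K' (i v) = i (mate K v) /\ lead K' (i v) = lead K v}.

Lemma transports_matches K K' : matches V K -> transports K K' ->
  matches (i @: V) K'.
Proof.
move=> mK tK _ /imsetP[v Vv ->]; have [e1 e2] := tK v Vv.
have [Vm km lm] := mK v Vv; have [e3 e4] := tK _ Vm.
by rewrite e1 e2 e3 e4 km lm imset_f.
Qed.

Lemma rel_sign_transport : transports M M' -> transports N N' ->
  rel_sign (i @: V) M' N' = rel_sign V M N.
Proof.
move=> tM tN; have [p Ap] := exists_aligns mM mN.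
have [p' [op ip np]] := transport_perm p.
have [off on] := alignsP _ _ _ _ Ap.
rewrite (rel_signE mM Ap) -op; apply: rel_signE.
  exact: transports_matches tM.
apply/alignsP; split=> [w nw|_ /imsetP[v Vv ->]].
  case: (boolP (w \in codom i)) => [/codomP[v e]|/np//].
  by rewrite e ip off //; apply: contra nw => Vv; rewrite e imset_f.
have [Vp e1 e2] := on v Vv; have [e3 e4] := tM v Vv; have [e5 e6] := tN _ Vp.
by rewrite e3 !ip e1 e5 e6 e2 e4 imset_f.
Qed.

End Transport.

Lemma rel_sign_set0 (T : finType) (M N : matching T) : rel_sign set0 M N = 0.
Proof.
rewrite (rel_signE (p := 1%g)) ?odd_perm1 // => [v|]; first by rewrite inE.
by apply/alignsP; split=> v; rewrite ?inE ?perm1.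
Qed.

Section Decomposition.
Variables (T : finType) (M N : matching T).
Implicit Types V W : {set T}.

Lemma rel_signU V W : [disjoint V & W] ->
    matches V M -> matches V N -> matches W M -> matches W N ->
  rel_sign (V :|: W) M N = rel_sign V M N + rel_sign W M N.
Proof.
move=> dVW mMV mNV mMW mNW.
have mMU : matches (V :|: W) M.
  by move=> v /setUP[/mMV|/mMW] [Vm -> ->]; rewrite inE Vm ?orbT.
have [p Ap] := exists_aligns mMV mNV; have [q Aq] := exists_aligns mMW mNW.
have [offp onp] := alignsP _ _ _ _ Ap; have [offq onq] := alignsP _ _ _ _ Aq.
rewrite (rel_signE mMV Ap) (rel_signE mMW Aq) -addbF2 -odd_permM.
apply: rel_signE => //; apply/alignsP; split=> v.
  by rewrite inE negb_or permM => /andP[nV nW]; rewrite offp // offq.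
have nW u : u \in V -> u \notin W by move=> Vu; rewrite (disjointFr dVW Vu).
have nV u : u \in W -> u \notin V by move=> Wu; rewrite (disjointFl dVW Wu).
case/setUP=> Uv; rewrite !permM.
  have [Vp e1 e2] := onp v Uv; rewrite e1 (offq (p v)) ?nW //.
  by rewrite offq ?nW ?mate_in // inE Vp.
have [Wq e1 e2] := onq v Uv.
by rewrite !offp ?nV ?mate_in // inE Wq orbT.
Qed.

Lemma rel_sign_fibres (S : finType) (F : T -> S) V :
    matches V M -> matches V N ->
    {in V, forall v, F (mate M v) = F v} ->
    {in V, forall v, F (mate N v) = F v} ->
  rel_sign V M N = \sum_s rel_sign [set v in V | F v == s] M N.
Proof.
move=> mM mN FM FN.
have fib K (P : pred S) : matches V K -> {in V, forall v, F (mate K v) = F v} ->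
    matches [set v in V | P (F v)] K.
  move=> mK FK v; rewrite !inE => /andP[Vv Pv].
  by have [-> -> ->] := mK v Vv; rewrite FK.
have VE : V = [set v in V | F v \in index_enum S].
  by apply/setP=> v; rewrite inE mem_index_enum andbT.
rewrite {1}VE; elim: (index_enum S) (index_enum_uniq S) => [|s r IHr] /=.
  rewrite big_nil => _; suff -> : [set v in V | F v \in [::]] = set0.
    exact: rel_sign_set0.
  by apply/setP=> v; rewrite !inE andbF.
case/andP=> ns ur; rewrite big_cons -IHr // -rel_signU //; do ?[exact: fib].
- congr (rel_sign _ M N); apply/setP=> v.
  by rewrite !inE -andb_orr.
- rewrite disjoint_subset; apply/subsetP=> v; rewrite !inE => /andP[_ /eqP->].
  by rewrite (negbTE ns) andbF.
- exact: (fib M (pred1 s)).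
- exact: (fib N (pred1 s)).
Qed.

End Decomposition.

(** Every circle has four points, told apart by their two leads; the
    permutation that exchanges the two leads carries [M] to [N], and it is one
    transposition on each circle. *)
Lemma rel_sign_commuting (T : finType) (V : {set T}) (M N : matching T) :
    matches V M -> matches V N ->
    {in V, forall v, mate M (mate N v) = mate N (mate M v)} ->
    {in V, forall v, lead M (mate N v) = lead M v} ->
    {in V, forall v, lead N (mate M v) = lead N v} ->
  rel_sign V M N = \sum_(v in V) (~~ lead M v)%:F * (~~ lead N v)%:F.
Proof.
move=> mM mN comm LMN LNM.
pose f v := if (v \in V) && (lead N v != lead M v) then mate M (mate N v) else v.
have Vf v : v \in V -> mate M (mate N v) \in V by move=> Vv; rewrite !mate_in.
have LN v : v \in V -> lead N (mate M (mate N v)) = ~~ lead N v.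
  by move=> Vv; rewrite LNM ?mate_in // (lead_mate mN).
have LM v : v \in V -> lead M (mate M (mate N v)) = ~~ lead M v.
  by move=> Vv; rewrite (lead_mate mM) ?mate_in // LMN.
have MNK v : v \in V -> mate M (mate N (mate M (mate N v))) = v.
  by move=> Vv; rewrite -comm ?mate_in // (mateK mM) ?mate_in // (mateK mN).
have fK : involutive f.
  move=> v; rewrite /f; case: (boolP (v \in V)) => Vv /=; last first.
    by rewrite (negbTE Vv).
  case: (boolP (lead N v != lead M v)) => d; last by rewrite Vv (negbTE d).
  by rewrite Vf // LN // LM // (inj_eq negb_inj) d MNK.
have Ap : aligns V M N (perm (inv_inj fK)).
  apply/alignsP; split=> v Vv; rewrite !permE /f; first by rewrite (negbTE Vv).
  rewrite (mate_in mM) // Vv LNM // (lead_mate mM) //=.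
  case: (boolP (lead N v != lead M v)) => d.
    have -> /= : (lead N v != ~~ lead M v) = false.
      by move: d; case: (lead M v); case: (lead N v).
    rewrite Vf // LN //.
    split=> //=; last by move: d; case: (lead M v); case: (lead N v).
    by rewrite comm // (mateK mN) // mate_in.
  have -> /= : lead N v != ~~ lead M v.
    by move: d; case: (lead M v); case: (lead N v).
  by rewrite Vv -comm // (mateK mM) ?mate_in //; split=> //; apply/eqP/negbNE.
rewrite (rel_signE mM Ap) (odd_involution
  (D := [set v in V | lead N v && ~~ lead M v])).
- apply: addF2_eq0; rewrite oddF2 cardF2 -big_split /=.
  transitivity (\sum_(v in V) (~~ lead M v)%:F).
    apply: eq_bigr => v _; rewrite andbF2 negbF2.
    by case: (lead M v); case: (lead N v); apply/eqP.
  by apply: (sum_mate0 mN) => v Vv; rewrite LMN.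
- by move=> v; rewrite !permE fK.
- move=> v; rewrite permE /f; case: (boolP (v \in V)) => Vv /=; rewrite ?eqxx //.
  case: (boolP (lead N v != lead M v)); rewrite ?eqxx // => d _.
  rewrite !inE Vf // LN // LM // Vv /=; move: d.
  by case: (lead M v); case: (lead N v).
- move=> v; rewrite inE permE /f => /and3P[Vv LNv nLM].
  rewrite Vv LNv (negbTE nLM) /=; apply/eqP=> e.
  by have := LN v Vv; rewrite e LNv.
Qed.

(** * Pairing the points of even fibres *)

Definition fibre (I : finType) (S : eqType) (x : I -> S) (R : {set I}) i :=
  enum [set j in R | x j == x i].

(** Positions 2n and 2n + 1 of each fibre, in the order of its enumeration, are
    paired. *)
Definition pairing (I : finType) (S : eqType) (x : I -> S) (R : {set I}) :=
  Matching
    (fun i => let k := index i (fibre x R i) in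
              nth i (fibre x R i) (if odd k then k.-1 else k.+1))
    (fun i => ~~ odd (index i (fibre x R i))).

Section Pairing.
Variables (I : finType) (S : eqType) (x : I -> S) (R : {set I}).
Hypothesis evenR : {in R, forall i, ~~ odd #|[set j in R | x j == x i]|}.

Lemma pairing_lt i : i \in R ->
  ((if odd (index i (fibre x R i)) then (index i (fibre x R i)).-1
    else (index i (fibre x R i)).+1) < size (fibre x R i))%N.
Proof.
move=> Ri; have si : i \in fibre x R i by rewrite mem_enum inE Ri eqxx.
have lt_k : (index i (fibre x R i) < size (fibre x R i))%N by rewrite index_mem.
case: ifP => ok; first by apply: leq_ltn_trans lt_k; apply: leq_pred.
have : ~~ odd (size (fibre x R i)) by rewrite -cardE evenR.
by rewrite ltn_neqAle lt_k andbT; apply: contraNneq => <-; rewrite /= ok.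
Qed.

Lemma pairing_fibre i : i \in R -> x (mate (pairing x R) i) = x i.
Proof.
move=> Ri; have := mem_nth i (pairing_lt Ri).
by rewrite mem_enum inE => /andP[_ /eqP].
Qed.

Lemma pairing_matches : matches R (pairing x R).
Proof.
move=> i Ri; have lt := pairing_lt Ri; have xm := pairing_fibre Ri.
have fm : fibre x R (mate (pairing x R) i) = fibre x R i by rewrite /fibre xm.
have si : i \in fibre x R i by rewrite mem_enum inE Ri eqxx.
have Rm : mate (pairing x R) i \in R.
  by have := mem_nth i lt; rewrite mem_enum inE => /andP[].
have := index_uniq i lt (enum_uniq _); rewrite -[nth _ _ _]/(mate (pairing x R) i).
move: fm Rm lt; move: (mate _ i) => j fj Rj; rewrite -/(fibre x R i) => lt idx.
split=> //=; rewrite fj idx.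
  have: nth j (fibre x R i) (index i (fibre x R i)) = i by rewrite nth_index.
  case ok: (odd (index _ _)) => /=; last by rewrite ok.
  by case: (index _ _) ok => //= n /negbTE->.
case ok: (odd (index _ _)) => /=; last by rewrite ok.
by case: (index _ _) ok => //= n /negbTE->.
Qed.

End Pairing.

(** * Intervals and corners *)

Section Intervals.
Variable X : framed_flow1cat.
Notation pt := (fc_pt X).
Notation cmp := (fc_cmp X).
Notation s := (@ffc_s X).
Implicit Types (u w : pt * pt) (J : cmp).

Definition composable w := fc_psrc w.1 == fc_ptgt w.2.

Definition opposite w : pt * pt :=
  if [pick u | (u != w) && [exists J, (w \in fc_bd J) && (u \in fc_bd J)]]
  is Some u then u else w.

Lemma interval_at w : composable w ->
  exists J, [/\ fc_bd J = [set w; opposite w], opposite w != w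
    & forall J', w \in fc_bd J' -> J' = J].
Proof.
case: w => B A /eqP/= BA; have /eqP/cards1P[J JE] := fc_bd_partition BA.
have inJ J' : ((B, A) \in fc_bd J') = (J' == J).
  by have /setP/(_ J') := JE; rewrite !inE.
have wJ : (B, A) \in fc_bd J by rewrite inJ.
exists J; have [/eqP|/eqP/cards2P[u [u' [nu JE2]]]] := fc_bd_card J.
  by rewrite cards_eq0 => /eqP J0; rewrite J0 inE in wJ.
have [u2 [nu2 JE3]] : exists u2, u2 != (B, A) /\ fc_bd J = [set (B, A); u2].
  move: wJ; rewrite JE2 !inE => /orP[]/eqP e.
    by exists u'; rewrite e eq_sym nu.
  by exists u; rewrite e nu setUC.
have oE : opposite (B, A) = u2.
  rewrite /opposite; case: pickP => [v /andP[nv /existsP[J' /andP[wJ' vJ']]]|/(_ u2)].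
    move: wJ' vJ'; rewrite inJ => /eqP->; rewrite JE3 !inE (negbTE nv) /=.
    by move/eqP.
  case/negP; rewrite nu2; apply/existsP; exists J.
  by rewrite JE3 !inE !eqxx orbT.
by rewrite oE; split=> // J'; rewrite inJ => /eqP.
Qed.

Lemma opposite_bd J w : w \in fc_bd J ->
  [/\ composable w, fc_bd J = [set w; opposite w] & opposite w != w].
Proof.
case: w => B A wJ; have [_ cw _] := fc_bdP wJ.
have co : composable (B, A) by apply/eqP.
by have [J' [e n u]] := interval_at co; rewrite (u J wJ).
Qed.

Lemma opposite_in_bd J w : w \in fc_bd J -> opposite w \in fc_bd J.
Proof. by case/opposite_bd=> _ -> _; rewrite set22. Qed.

Lemma oppositeP w : composable w ->
  [/\ composable (opposite w), opposite (opposite w) = w,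
      fc_ptgt (opposite w).1 = fc_ptgt w.1,
      fc_psrc (opposite w).2 = fc_psrc w.2 & gm_s (opposite w) = gm_s w + 1].
Proof.
move=> cw; have [J [JE nw _]] := interval_at cw.
have wJ : w \in fc_bd J by rewrite JE set21.
have oJ := opposite_in_bd wJ; have [co JE' no] := opposite_bd oJ.
have ooE : opposite (opposite w) = w.
  have : w \in [set opposite w; opposite (opposite w)] by rewrite -JE'.
  by rewrite !inE eq_sym (negbTE nw) => /eqP.
case: w (opposite w) cw JE nw wJ oJ co JE' no ooE => B A [B' A'] cw JE nw wJ oJ co _ _ ooE.
have [-> _ ->] := fc_bdP wJ; have [-> _ ->] := fc_bdP oJ; split=> //.
have : (B, A) != (B', A') by rewrite eq_sym.
move/ffc_signP => /(_ J JE); rewrite /gm_s /=.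
move: (s B) (s A) (s B') (s A') => a b c d h; rewrite -h.
by case: (F2P a) => ->; case: (F2P b) => ->; case: (F2P c) => ->;
   case: (F2P d) => ->; apply/eqP.
Qed.

End Intervals.

Section LiftedMatchings.
Variable X : framed_flow1cat.
Notation pt := (fc_pt X).

(** A triple ((P, B), A) with P in M(c, d), B in M(b, c) and A in M(a, b) is the
    end point of an interval I x {A}, which moves P and B, and of an interval
    {P} x J, which moves B and A. *)
Definition on_fst (Y A : Type) (t : Y -> Y) (v : Y * A) := (t v.1, v.2).

Definition lower_opposite (I : Type) (v : I * pt * pt) : I * pt * pt :=
  let w := opposite (v.1.2, v.2) in (v.1.1, w.1, w.2).

Arguments lower_opposite : simpl never.

Definition sign2 (I : Type) (v : I * pt * pt) : 'F_2 := gm_s (v.1.2, v.2).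

Definition sign3 (v : pt * pt * pt) : 'F_2 := ffc_s v.1.1 + sign2 v.

(** The corners of the boundaries of the M(a, d) with d in [R]. *)
Definition cornerset (R : {set fc_ob X}) (a : fc_ob X) : {set pt * pt * pt} :=
  [set v | [&& fc_ptgt v.1.1 \in R, composable v.1, composable (v.1.2, v.2)
             & fc_psrc v.2 == a]].

Definition upper (h : pt * pt * pt -> bool) := Matching (on_fst (@opposite X)) h.
Definition lower (h : pt * pt * pt -> bool) := Matching (@lower_opposite pt) h.

Lemma lower_oppositeP (I : Type) (v : I * pt * pt) : composable (v.1.2, v.2) ->
  [/\ lower_opposite (lower_opposite v) = v, sign2 (lower_opposite v) = sign2 v + 1,
      fc_ptgt (lower_opposite v).1.2 = fc_ptgt v.1.2,
      fc_psrc (lower_opposite v).2 = fc_psrc v.2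
    & composable ((lower_opposite v).1.2, (lower_opposite v).2)].
Proof.
case: v => [[i B] A] /oppositeP[]; rewrite /lower_opposite /sign2 /=.
by case: (opposite (B, A)) => B' A' /= -> -> -> -> ->.
Qed.

Lemma upper_matches R a h :
    {in cornerset R a, forall v, h (on_fst (@opposite X) v) = ~~ h v} ->
  matches (cornerset R a) (upper h).
Proof.
move=> hP v Vv; split=> //=; last exact: hP.
  move: Vv; rewrite !inE /= => /and4P[tR /oppositeP[-> _ -> e _] c2 ->].
  by rewrite tR /composable /= e; move: c2; rewrite /composable /= => ->.
move: Vv; rewrite !inE => /and4P[_ /oppositeP[_ oo _ _ _] _ _].
by rewrite /on_fst /= oo; case: (v).
Qed.

Lemma lower_matches R a h :
    {in cornerset R a, forall v, h (lower_opposite v) = ~~ h v} ->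
  matches (cornerset R a) (lower h).
Proof.
move=> hP v Vv; split=> //=; last exact: hP; move: Vv; rewrite !inE.
  case/and4P=> tR c1 /lower_oppositeP[_ _ e1 e2 ->].
  rewrite e2 => ->; rewrite tR !andbT.
  by move: c1; rewrite /composable e1 => ->.
by case/and4P=> tR c1 /lower_oppositeP[].
Qed.

Lemma sign3_lower R a v : v \in cornerset R a ->
  sign3 (lower_opposite v) = sign3 v + 1.
Proof.
by rewrite inE => /and4P[_ _ /lower_oppositeP[_ e _ _ _] _]; rewrite /sign3 e addrA.
Qed.

Lemma sign3_upper R a v : v \in cornerset R a ->
  sign3 (on_fst (@opposite X) v) = sign3 v + 1.
Proof.
rewrite inE => /and4P[_ /oppositeP[_ _ _ _ e] _ _].
rewrite /sign3 /sign2 /gm_s /= !addrA; move: e; rewrite /gm_s => ->.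
exact: addrAC.
Qed.

Lemma upper_sign_matches R a :
  matches (cornerset R a) (upper (fun v => sign3 v == 0)).
Proof. by apply: upper_matches => v /sign3_upper->; apply: F2_eq0_flip. Qed.

Lemma lower_sign_matches R a :
  matches (cornerset R a) (lower (fun v => sign3 v == 1)).
Proof. by apply: lower_matches => v /sign3_lower->; apply: F2_eq1_flip. Qed.

End LiftedMatchings.

Arguments corners : simpl never.

(** * The compatibility condition as a relative sign *)

Section Compatibility.
Variables (X : framed_flow1cat).
Notation pt := (fc_pt X).
Notation cmp := (fc_cmp X).
Notation s := (@ffc_s X).
Notation f := (@ffc_f X).

Section OneTarget.
Variables a d : fc_ob X.
Let V := cornerset [set d] a.
Let D := bd_pieces a d.
Let U := upper (X := X) (fun v => sign3 v == 0).
Let L := lower (X := X) (fun v => sign3 v == 1).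
Let mU : matches V U := @upper_sign_matches _ _ _.
Let mL : matches V L := @lower_sign_matches _ _ _.

Lemma corners_inl J Q v : v \in corners (inl (J, Q)) ->
  [/\ v.1 \in fc_bd J, v.2 = Q & corners (inl (J, Q)) = [set v; mate U v]].
Proof.
case/imsetP=> w wJ -> /=; split=> //; first by case: (w) wJ.
rewrite /corners; have [_ -> _] := opposite_bd wJ.
by rewrite imsetU1 imset_set1 /on_fst; case: w {wJ} => B A /=; case: (opposite (B, A)).
Qed.

Lemma corners_inr P J v : v \in corners (inr (P, J)) ->
  [/\ v.1.1 = P, (v.1.2, v.2) \in fc_bd J
    & corners (inr (P, J)) = [set v; mate L v]].
Proof.
case/imsetP=> w wJ -> /=; split=> //; first by case: (w) wJ.
rewrite /corners; have [_ -> _] := opposite_bd wJ.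
by rewrite imsetU1 imset_set1 /lower_opposite; case: w {wJ} => B A /=; case: (opposite (B, A)).
Qed.

Lemma cornersV x v : x \in D -> v \in corners x -> v \in V.
Proof.
case: x => [[J Q]|[P J]]; rewrite inE.
  case/and3P=> /eqP sQ /eqP eJ /eqP tJ /corners_inl[vJ vQ _].
  have [cv _ _] := opposite_bd vJ; case: v vJ vQ cv => [[P B] A] /= vJ -> cv.
  have [e1 e2 e3] := fc_bdP vJ.
  by rewrite inE /= e1 tJ set11 cv sQ eqxx andbT /composable /= e3 eJ eqxx.
case/and3P=> /eqP sJ /eqP eJ /eqP tP /corners_inr[vP vJ _].
have [cv _ _] := opposite_bd vJ; case: v vJ vP cv => [[P' B] A] /= vJ -> cv.
have [e1 e2 e3] := fc_bdP vJ.
by rewrite inE /= tP set11 cv e3 sJ eqxx !andbT /composable /= eJ e1 eqxx.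
Qed.

Lemma upper_piece v : v \in V -> exists J,
  inl (J, v.2) \in D /\ v \in corners (inl (J, v.2)).
Proof.
rewrite inE in_set1 => /and4P[/eqP td c1 c2 /eqP sa].
have [J [JE _ _]] := interval_at c1; have vJ : v.1 \in fc_bd J by rewrite JE set21.
exists J; split; last by apply/imsetP; exists v.1 => //; case: (v) => [[]].
have := @fc_bdP _ J v.1.1 v.1.2; rewrite -surjective_pairing => /(_ vJ)[e1 e2 e3].
by rewrite inE sa -e3 -e1 td !eqxx (eqP c2) eqxx.
Qed.

Lemma lower_piece v : v \in V -> exists J,
  [/\ inr (v.1.1, J) \in D, v \in corners (inr (v.1.1, J))
    & forall P J', inr (P, J') \in D -> v \in corners (inr (P, J')) ->
       P = v.1.1 /\ J' = J].
Proof.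
rewrite inE in_set1 => /and4P[/eqP td c1 c2 /eqP sa].
have [J [JE _ JU]] := interval_at c2.
have vJ : (v.1.2, v.2) \in fc_bd J by rewrite JE set21.
exists J; split; last 1 first.
- by move=> P J' _ /corners_inr[-> /JU].
- have [e1 e2 e3] := fc_bdP vJ.
  by rewrite inE -e3 sa -e1 td !eqxx (eqP c1) eqxx.
by apply/imsetP; exists (v.1.2, v.2) => //; case: (v) => [[]].
Qed.

Lemma circle_corners (x : piece X) : is_circle (piece_cmp x) -> corners x = set0.
Proof.
by rewrite /is_circle /corners cards_eq0; case: x => [[J Q]|[P J]] /= /eqP->;
  rewrite imset0.
Qed.

Lemma interval_corners (x : piece X) : ~~ is_circle (piece_cmp x) ->
  exists v, v \in corners x.
Proof.
rewrite /is_circle cards_eq0 => /set0Pn[w wJ].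
case: x wJ => [[J Q]|[P J]] /= wJ.
  by exists (w, Q); apply/imsetP; exists w => //; case: (w).
by exists (P, w.1, w.2); apply/imsetP; exists w.
Qed.

Lemma glued_sym : symmetric (glued a d).
Proof.
by move=> x y; apply/and3P/and3P => -[Dx Dy]; rewrite setIC; split.
Qed.

Definition piece_class x := [set y in D | connect (glued a d) x y].

Lemma in_piece_class x y :
  (y \in piece_class x) = (y \in D) && connect (glued a d) x y.
Proof. by rewrite in_set. Qed.

Lemma bd_componentsE : bd_components a d = piece_class @: D.
Proof. by []. Qed.

Lemma class_partition : partition (bd_components a d) D.
Proof.
apply: equivalence_partitionP => x y z _ _ _; split=> // xy.
by apply: same_connect => //; apply: sym_connect_sym glued_sym.
Qed.

Lemma piece_class_eq x y : x \in D -> y \in D -> connect (glued a d) x y ->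
  piece_class x = piece_class y.
Proof.
move=> Dx Dy xy; apply/setP=> z; rewrite !in_piece_class.
by rewrite (same_connect (sym_connect_sym glued_sym) xy).
Qed.

Lemma circle_class (x y : piece X) : is_circle (piece_cmp x) ->
  connect (glued a d) x y ->
  y = x.
Proof.
move/circle_corners=> x0 /connectP[[_ ->//|z r]].
by case/andP=> /and3P[_ _]; rewrite x0 set0I eqxx.
Qed.

Definition corner_class v :=
  [set y in D | [exists x in D, (v \in corners x) && connect (glued a d) x y]].

Lemma corner_classE x v : x \in D -> v \in corners x ->
  corner_class v = piece_class x.
Proof.
move=> Dx vx; apply/setP=> y; rewrite in_piece_class [LHS]in_set; case: (boolP (y \in D)) => //= Dy.
apply/exists_inP/idP => [[z Dz /andP[vz zy]]|xy]; last by exists x; rewrite ?vx.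
apply: connect_trans zy; apply: connect1; apply/and3P; split=> //.
by apply/set0Pn; exists v; rewrite inE vx.
Qed.

Let step : rel (pt * pt * pt) :=
  [rel v w | (w == mate U v) || (w == mate L v)].

Lemma corners_step x v w : v \in corners x -> w \in corners x -> connect step v w.
Proof.
case: x => [[J Q]|[P J]].
  case/corners_inl=> _ _ ->; rewrite !inE => /orP[]/eqP-> //.
  by apply: connect1; apply/orP; left.
case/corners_inr=> _ _ ->; rewrite !inE => /orP[]/eqP-> //.
by apply: connect1; apply/orP; right.
Qed.

Lemma connect_step x y v w : v \in corners x -> w \in corners y ->
  connect (glued a d) x y -> connect step v w.
Proof.
move=> vx wy /connectP[r]; elim: r x v vx => [|z r IHr] x v vx /=.
  by move=> _ yx; apply: (corners_step vx); rewrite -yx.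
case/andP=> /and3P[_ _ /set0Pn[u]]; rewrite inE => /andP[ux uz] pr lr.
exact: connect_trans (corners_step vx ux) (IHr _ _ uz pr lr).
Qed.

Lemma corner_class_count :
  rel_sign V U L = #|corner_class @: V|%:R.
Proof.
apply: (rel_sign_alternating mU mL) => [v _|v Vv|v Vv|v w Vv Vw e] /=.
- by case: (F2P (sign3 v)) => ->.
- have [J [Dx vx]] := upper_piece Vv; rewrite (corner_classE Dx vx).
  by apply: corner_classE => //; have [_ _ ->] := corners_inl vx; rewrite set22.
- have [J [Dx vx _]] := lower_piece Vv; rewrite (corner_classE Dx vx).
  by apply: corner_classE => //; have [_ _ ->] := corners_inr vx; rewrite set22.
have [J [Dx vx]] := upper_piece Vv; have [J' [Dy wy]] := upper_piece Vw.
apply: (connect_step vx wy).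
move: e; rewrite (corner_classE Dx vx) (corner_classE Dy wy) => /setP/(_ (inl (J', w.2))).
by rewrite !in_piece_class Dy connect0 /= => ->.
Qed.

Definition weight (x : piece X) : 'F_2 := f (piece_cmp x) +
  if x is inr (P, J) then (~~ is_circle J)%:F * (1 + s P) else 0.

(** The term of a boundary circle in the compatibility condition: the second
    summand tells whether it contains corners. A circle without corners
    contributes 1 + (1 + f), which is its weight. *)
Lemma tilde_frameE K : K \in bd_components a d ->
  1 + tilde_frame s f K = \sum_(x in K) weight x + (K \in corner_class @: V)%:F.
Proof.
rewrite bd_componentsE => /imsetP[x0 Dx0 KE].
rewrite /tilde_frame; case: pickP => [x /andP[Kx cx]|noc].
  have /andP[Dx x0x] : (x \in D) && connect (glued a d) x0 x.
    by move: Kx; rewrite KE in_piece_class.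
  have {}KE : K = [set x].
    rewrite KE (piece_class_eq Dx0 Dx x0x); apply/setP=> y; rewrite in_piece_class inE.
    apply/andP/eqP=> [[_ /circle_class]|->]; [exact | by rewrite connect0].
  rewrite KE big_set1 addrA (_ : 1 + 1 = 0) ?add0r; last by apply/eqP.
  suff -> : ([set x] \in corner_class @: V) = false.
    by rewrite addr0 /weight; case: (x) cx => [[J Q]|[P J]] /= cx;
      rewrite ?cx ?mul0r addr0.
  apply/negP=> /imsetP[v Vv e]; have [J [Dy vy]] := upper_piece Vv.
  have /setP/(_ (inl (J, v.2))) := e; rewrite (corner_classE Dy vy) in_piece_class inE Dy connect0.
  by move=> /eqP yx; rewrite yx circle_corners // inE in vy.
suff -> : K \in corner_class @: V.
  rewrite addrC; congr (_ + _); apply: eq_bigr => x Kx.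
  have := noc x; rewrite Kx /weight => /= cx.
  by case: x {Kx} cx => [[J Q]|[P J]] /= cx; rewrite ?addr0 // cx mul1r addrC.
have [v vx0] : exists v, v \in corners x0.
  apply: interval_corners; have := noc x0.
  by rewrite KE in_piece_class Dx0 connect0 /= => ->.
by apply/imsetP; exists v; rewrite ?(cornersV Dx0 vx0) // (corner_classE Dx0 vx0).
Qed.

Lemma corner_class_sub : corner_class @: V \subset bd_components a d.
Proof.
apply/subsetP=> _ /imsetP[v Vv ->]; have [J [Dx vx]] := upper_piece Vv.
by rewrite (corner_classE Dx vx) bd_componentsE imset_f.
Qed.

(** Each interval {P} x J has exactly one end point of total sign 0. *)
Lemma lower_weight : \sum_(x : pt * cmp | inr x \in D)
    (~~ is_circle x.2)%:F * (1 + s x.1) =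
  \sum_(v in V) (1 + sign3 v) * (1 + s v.1.1).
Proof.
transitivity (\sum_(x : pt * cmp | inr x \in D)
    \sum_(v in corners (inr x)) (1 + sign3 v) * (1 + s v.1.1)).
  apply: eq_bigr => -[P J] Dx; case: (boolP (is_circle J)) => /= cJ.
    by rewrite mul0r (@circle_corners (inr (P, J))) // big_set0.
  have [v vx] := @interval_corners (inr (P, J)) cJ.
  have [vP _ E] := corners_inr vx; have Vv := cornersV Dx vx.
  rewrite E big_setU1 ?big_set1 /=; last first.
    by rewrite inE eq_sym; apply: mate_neq mL Vv.
  rewrite (sign3_lower Vv) /lower_opposite /= vP.
  by case: (F2P (sign3 v)) => ->; case: (F2P (s P)) => ->; apply/eqP.
rewrite (exchange_big_dep (mem V)) /=; last by move=> x v; apply: cornersV.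
apply: eq_bigr => v Vv; have [J [Dx vx Ux]] := lower_piece Vv.
rewrite (big_pred1 (v.1.1, J)) // => -[P J']; rewrite /= xpair_eqE.
by apply/andP/andP=> [[Dy vy]|[/eqP-> /eqP->] //]; have [-> ->] := Ux _ _ Dy vy.
Qed.

Lemma compatibility_one : fc_gr a = fc_gr d + 3 ->
  rel_sign V U L =
    \sum_(x : cmp * pt | inl x \in D) f x.1
    + \sum_(x : pt * cmp | inr x \in D) f x.2
    + \sum_(v in V) (1 + sign3 v) * (1 + s v.1.1).
Proof.
move=> gr; rewrite corner_class_count; apply: addF2_eq0.
rewrite -lower_weight -addrA -big_split /=.
have := @ffc_compatP X a d gr.
rewrite (eq_bigr _ tilde_frameE) big_split /=.
rewrite -(set_partition_big _ class_partition) /=.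
have -> : \sum_(x in D) weight x = \sum_(x : cmp * pt | inl x \in D) f x.1 +
    \sum_(x : pt * cmp | inr x \in D)
      (f x.2 + (~~ is_circle x.2)%:F * (1 + s x.1)).
  rewrite big_sumType /=; congr (_ + _); apply: eq_bigr => -[? ?] _ //.
  by rewrite /weight addr0.
move=> e; rewrite -[RHS]e [LHS]addrC; congr (_ + _).
rewrite -natr_sum; congr (_%:R); rewrite -sum1_card.
rewrite [RHS]big_mkcond [LHS]big_mkcond; apply: eq_bigr => K _.
have := subsetP corner_class_sub K; case: (K \in corner_class @: V) => [->//|_].
by case: ifP.
Qed.

End OneTarget.

(** The edges I x {A} and {P} x J both change the total sign, so ordering the
    former from 0 to 1 and the latter from 1 to 0 gives alternating orders, and
    the relative sign counts the circles with corners. *)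
Theorem compatibility_rel_sign (R : {set fc_ob X}) a :
    {in R, forall d, fc_gr a = fc_gr d + 3} ->
  rel_sign (cornerset R a) (upper (X := X) (fun v => sign3 v == 0))
      (lower (X := X) (fun v => sign3 v == 1)) =
    \sum_(x : cmp * pt | [&& fc_psrc x.2 == a, fc_csrc x.1 == fc_ptgt x.2
        & fc_ctgt x.1 \in R]) f x.1
    + \sum_(x : pt * cmp | [&& fc_csrc x.2 == a, fc_psrc x.1 == fc_ctgt x.2
        & fc_ptgt x.1 \in R]) f x.2
    + \sum_(v in cornerset R a) (1 + sign3 v) * (1 + s v.1.1).
Proof.
move=> gr; rewrite (rel_sign_fibres (F := fun v => fc_ptgt v.1.1)).
- have fibE d : [set v in cornerset R a | fc_ptgt v.1.1 == d] =
      if d \in R then cornerset [set d] a else set0.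
    case: ifP => Rd; apply/setP=> v; rewrite !inE; last first.
      by case: (eqVneq (fc_ptgt v.1.1) d) => [->|_]; rewrite ?Rd ?andbF.
    by case: (eqVneq (fc_ptgt v.1.1) d) => [->|_]; rewrite ?Rd ?andbF ?andbT.
  transitivity (\sum_(d in R) (
      \sum_(x : cmp * pt | [&& fc_psrc x.2 == a, fc_csrc x.1 == fc_ptgt x.2
        & fc_ctgt x.1 == d]) f x.1
      + \sum_(x : pt * cmp | [&& fc_csrc x.2 == a, fc_psrc x.1 == fc_ctgt x.2
        & fc_ptgt x.1 == d]) f x.2
      + \sum_(v in cornerset [set d] a) (1 + sign3 v) * (1 + s v.1.1))).
    rewrite [RHS]big_mkcond; apply: eq_bigr => d _; rewrite fibE; case: ifP => Rd.
      rewrite compatibility_one; last exact: gr.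
      by congr (_ + _ + _); apply: eq_bigl => -[? ?]; rewrite inE.
    exact: rel_sign_set0.
  rewrite !big_split /=; congr (_ + _ + _).
  - rewrite [RHS](partition_big (fun x => fc_ctgt x.1) (mem R)) /=; last first.
      by move=> x /and3P[].
    apply: eq_bigr => d Rd; apply: eq_bigl => x.
    by case: (eqVneq (fc_ctgt x.1) d) => [->|_]; rewrite ?Rd ?andbF ?andbT.
  - rewrite [RHS](partition_big (fun x => fc_ptgt x.1) (mem R)) /=; last first.
      by move=> x /and3P[].
    apply: eq_bigr => d Rd; apply: eq_bigl => x.
    by case: (eqVneq (fc_ptgt x.1) d) => [->|_]; rewrite ?Rd ?andbF ?andbT.
  rewrite [RHS](partition_big (fun v => fc_ptgt v.1.1) (mem R)) /=; last first.
    by move=> x; rewrite inE => /andP[].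
  apply: eq_bigr => d Rd; apply: eq_bigl => v.
  by have /setP/(_ v) := fibE d; rewrite Rd !inE => ->.
- exact: upper_sign_matches.
- exact: lower_sign_matches.
- by move=> v; rewrite inE => /and4P[_ /oppositeP[_ _ e _ _] _ _].
- by [].
Qed.

End Compatibility.

(** * sq as a relative sign *)

Section MatchedGraph.
Variables (X : framed_flow1cat) (k : int) (phi : cochain X k).
Variables (C : boundary_matching phi).
Notation pt := (fc_pt X).
Notation cmp := (fc_cmp X).
Notation s := (@ffc_s X).
Notation f := (@ffc_f X).

Definition bm_mate (B : pt) : pt :=
  if [pick B' | ((B, B') \in bm_pairs C) || ((B', B) \in bm_pairs C)] is Some B'
  then B' else B.

Definition bm_lead (B : pt) := [exists B', (B, B') \in bm_pairs C].

Definition bm_matching := Matching bm_mate bm_lead.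

Definition phi_points : {set pt} := [set B | fc_ptgt B \in rep_obs phi].

Lemma bm_unique B B1 B2 B1' B2' : (B1, B2) \in bm_pairs C ->
    (B1', B2') \in bm_pairs C -> (B == B1) || (B == B2) ->
    (B == B1') || (B == B2') -> (B1, B2) = (B1', B2').
Proof.
move=> p p' e e'; have [_ t1 t2 s12] := bm_pairs_phi p.
have MB : B \in mod0_phi phi (fc_psrc B).
  by rewrite mem_mod0_phi eqxx andbT; case/orP: e => /eqP->.
have /eqP/cards1P[q /setP qE] := bm_partition C MB.
have := qE (B1, B2); have := qE (B1', B2').
by rewrite !inE /= p p' e e' => /esym/eqP-> /esym/eqP->.
Qed.

Lemma bm_pairE B1 B2 : (B1, B2) \in bm_pairs C ->
  [/\ bm_mate B1 = B2, bm_mate B2 = B1, bm_lead B1 & ~~ bm_lead B2].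
Proof.
move=> p; have [n _ _ _] := bm_pairs_phi p; split.
- rewrite /bm_mate; case: pickP => [B /orP[] q|/(_ B2)]; last by rewrite p.
    by have := bm_unique (B := B1) p q; rewrite !eqxx => /(_ isT isT)[].
  have := bm_unique (B := B1) p q; rewrite !eqxx orbT => /(_ isT isT)[_ e].
  by rewrite e eqxx in n.
- rewrite /bm_mate; case: pickP => [B /orP[] q|/(_ B1)]; last by rewrite p orbT.
    have := bm_unique (B := B2) p q; rewrite !eqxx orbT => /(_ isT isT)[e _].
    by rewrite e eqxx in n.
  by have := bm_unique (B := B2) p q; rewrite !eqxx !orbT => /(_ isT isT)[].
- by apply/existsP; exists B2.
apply/existsP=> -[B q]; have := bm_unique (B := B2) p q.
by rewrite !eqxx orbT => /(_ isT isT)[e _]; rewrite e eqxx in n.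
Qed.

Lemma bm_cases B : B \in phi_points ->
  if bm_lead B then (B, bm_mate B) \in bm_pairs C
  else (bm_mate B, B) \in bm_pairs C.
Proof.
rewrite inE => tB; have MB : B \in mod0_phi phi (fc_psrc B).
  by rewrite mem_mod0_phi tB eqxx.
have /eqP/cards1P[[B1 B2] /setP/(_ (B1, B2))] := bm_partition C MB.
rewrite !inE eqxx => /andP[p]; have [e1 e2 l1 l2] := bm_pairE p.
by case/orP=> /eqP->; rewrite ?l1 ?e1 // (negbTE l2) e2.
Qed.

Lemma bm_src B : B \in phi_points -> fc_psrc (bm_mate B) = fc_psrc B.
Proof. by move/bm_cases; case: ifP => _ /bm_pairs_phi[]. Qed.

Lemma bm_matches : matches phi_points bm_matching.
Proof.
move=> B /bm_cases; rewrite [lead _]/= [mate _]/=.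
case: ifP => l p; have [e1 e2 l1 l2] := bm_pairE p; have [_ t1 t2 _] := bm_pairs_phi p.
  by rewrite inE e2 (negbTE l2).
by rewrite inE e1 l1.
Qed.

Variable a : fc_ob X.
Let V := gm_V phi a.
Let G := matched_graph C a.

Definition flow_matching := Matching (@opposite X) (fun v => gm_s v == 0).
Definition pair_matching :=
  Matching (on_fst bm_mate) (fun v : pt * pt => bm_lead v.1).

Lemma gm_VE v : (v \in V) =
  [&& v.1 \in phi_points, composable v & fc_psrc v.2 == a].
Proof. by rewrite mem_gm_V inE. Qed.

Lemma flow_matches : matches V flow_matching.
Proof.
move=> v; rewrite gm_VE inE => /and3P[tv cv sv].
have [co oo e1 e2 e3] := oppositeP cv; split=> //=; last first.
  by rewrite e3 F2_eq0_flip.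
by rewrite gm_VE inE e1 tv co e2.
Qed.

Lemma pair_matches : matches V pair_matching.
Proof.
move=> v; rewrite gm_VE => /and3P[tv cv sv].
have [mt mm ml] := bm_matches tv; split=> //=.
  by rewrite gm_VE /= mt sv andbT /composable /= bm_src.
by rewrite /on_fst /=; move: mm => /= ->; case: (v).
Qed.

Definition match_edge (v : pt * pt) : gm_edge X :=
  inr ((if bm_lead v.1 then (v.1, bm_mate v.1) else (bm_mate v.1, v.1)), v.2).

Definition flow_edge (v : pt * pt) : gm_edge X :=
  if [pick J | v \in fc_bd J] is Some J then inl J else match_edge v.

Lemma flow_edgeP v : v \in V ->
  [/\ flow_edge v \in gm_E1 phi a, gm_ends (flow_edge v) = [set v; opposite v]
    & forall e, e \in gm_E1 phi a -> v \in gm_ends e -> e = flow_edge v].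
Proof.
rewrite gm_VE inE => /and3P[tv cv /eqP sv].
have [J [JE n JU]] := interval_at cv; have vJ : v \in fc_bd J by rewrite JE set21.
have eE : flow_edge v = inl J.
  rewrite /flow_edge; case: pickP => [J' /JU->//|/(_ J)]; by rewrite vJ.
rewrite eE; split=> // [|[J'|e] E1]; last 2 first.
- by move=> /JU->.
- by rewrite gm_E1_inr in E1.
case: v vJ tv cv sv JE n {JU eE} => B A vJ tv cv sv JE n.
have [e1 e2 e3] := fc_bdP vJ.
by rewrite gm_E1P -e1 tv -e3 sv eqxx /is_interval JE cards2 [(B, A) == _]eq_sym n.
Qed.

Lemma match_edgeP v : v \in V ->
  [/\ match_edge v \in gm_Ematch C a,
      gm_ends (match_edge v) = [set v; on_fst bm_mate v]
    & forall e, e \in gm_Ematch C a -> v \in gm_ends e -> e = match_edge v].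
Proof.
case: v => B A; rewrite gm_VE => /and3P[/= tv cv /eqP sv].
have := bm_cases tv; split.
- rewrite /match_edge /=; case: ifP H => l p; rewrite gm_EmatchP p sv eqxx /=.
    exact: cv.
  by move: cv; rewrite /composable /= bm_src.
- rewrite /match_edge /on_fst /=; case: ifP => l //=; exact: setUC.
move=> [J|[[B1 B2] A']]; first by rewrite gm_Ematch_inl.
rewrite gm_EmatchP => /and3P[p _ _]; have [e1 e2 l1 l2] := bm_pairE p.
by rewrite !inE /match_edge => /orP[]/eqP[-> ->] /=;
  rewrite ?l1 ?e1 // (negbTE l2) e2.
Qed.

Let adj : rel (pt * pt) := @sg_adj G.
Let mF : matches V flow_matching := flow_matches.
Let mP : matches V pair_matching := pair_matches.

Lemma edge_at e v : e \in gm_E C a -> v \in gm_ends e ->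
  v \in V /\ ((e = flow_edge v) \/ (e = match_edge v)).
Proof.
move=> Ee ve; have [/subsetP/(_ v ve) Vv _] := gm_endsP Ee; split=> //.
have [_ _ U1] := flow_edgeP Vv; have [_ _ U2] := match_edgeP Vv.
by case/setUP: Ee => [/U1/(_ ve)|/U2/(_ ve)]; [left|right].
Qed.

Lemma flow_edge_in v : v \in V -> flow_edge v \in gm_E C a.
Proof. by move=> Vv; have [E _ _] := flow_edgeP Vv; rewrite inE E. Qed.

Lemma match_edge_in v : v \in V -> match_edge v \in gm_E C a.
Proof. by move=> Vv; have [E _ _] := match_edgeP Vv; rewrite inE E orbT. Qed.

Lemma flow_edge_end v : v \in V -> v \in gm_ends (flow_edge v).
Proof. by move=> Vv; have [_ -> _] := flow_edgeP Vv; rewrite set21. Qed.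

Lemma match_edge_end v : v \in V -> v \in gm_ends (match_edge v).
Proof. by move=> Vv; have [_ -> _] := match_edgeP Vv; rewrite set21. Qed.

Lemma flow_edge_neq v : v \in V -> flow_edge v != match_edge v.
Proof.
move=> Vv; have [E1 _ _] := flow_edgeP Vv; have [E2 _ _] := match_edgeP Vv.
by apply: contraTneq E2 => <-; rewrite (gm_E1_dis C E1).
Qed.

Lemma flow_edge_mate v : v \in V -> flow_edge (opposite v) = flow_edge v.
Proof.
move=> Vv; have [E1 EE _] := flow_edgeP Vv.
have [_ _ U] := flow_edgeP (mate_in mF Vv).
by symmetry; apply: U => //; rewrite EE set22.
Qed.

Lemma match_edge_mate v : v \in V ->
  match_edge (on_fst bm_mate v) = match_edge v.
Proof.
move=> Vv; have [E1 EE _] := match_edgeP Vv.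
have [_ _ U] := match_edgeP (mate_in mP Vv).
by symmetry; apply: U => //; rewrite EE set22.
Qed.

Lemma adj_edge e v w : e \in gm_E C a -> v \in gm_ends e -> w \in gm_ends e ->
  adj v w.
Proof. by move=> Ee ve we; apply/exists_inP; exists e => //; rewrite ve. Qed.

Lemma adj_sym : connect_sym (adj).
Proof.
apply: sym_connect_sym => v w.
by apply/exists_inP/exists_inP => -[e Ee]; rewrite andbC; exists e.
Qed.

Lemma adjP v w : v \in V -> adj v w ->
  [\/ w = v, w = opposite v | w = on_fst bm_mate v].
Proof.
move=> Vv /exists_inP[e Ee /andP[ve we]].
have [_ EF _] := flow_edgeP Vv; have [_ EM _] := match_edgeP Vv.
have {}we : w \in gm_ends e by [].
case: (edge_at Ee ve) => _ [] e_v; move: we; rewrite e_v ?EF ?EM.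
  by case/set2P=> ->; [constructor 1|constructor 2].
by case/set2P=> ->; [constructor 1|constructor 3].
Qed.

Let step : rel (pt * pt) :=
  [rel v w | (w == mate flow_matching v) || (w == mate pair_matching v)].

Lemma connect_adj v w : v \in V -> connect (adj) v w ->
  w \in V /\ connect step v w.
Proof.
move=> Vv /connectP[r]; elim: r v Vv => [|u r IHr] v Vv /= => [_ ->//|].
case/andP=> /(adjP Vv) vu pr lr.
have [Vu su] : u \in V /\ connect step v u.
  case: vu => ->; split=> //.
  - exact: (mate_in mF Vv).
  - by apply: connect1; apply/orP; left.
  - exact: (mate_in mP Vv).
  - by apply: connect1; apply/orP; right.
by have [Vw sw] := IHr u Vu pr lr; split=> //; apply: connect_trans su sw.
Qed.

Definition comp v : {set pt * pt} := [set w in V | connect (adj) v w].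

Lemma in_comp v w : (w \in comp v) = (w \in V) && connect (adj) v w.
Proof. by rewrite in_set. Qed.

Lemma sg_componentsE : sg_components G = comp @: V.
Proof. by []. Qed.

Lemma component_partition : partition (sg_components G) V.
Proof.
apply: equivalence_partitionP => x y z _ _ _; split=> // xy.
by apply: same_connect => //; apply: adj_sym.
Qed.

Lemma comp_eq v w : connect (adj) v w -> comp v = comp w.
Proof.
by move=> vw; apply/setP=> u; rewrite !in_comp (same_connect adj_sym vw).
Qed.

Lemma component_comp K v : K \in sg_components G -> v \in K -> v \in V /\ comp v = K.
Proof.
rewrite sg_componentsE => /imsetP[u Vu ->]; rewrite in_comp => /andP[Vv uv].
by rewrite (comp_eq uv).
Qed.

Lemma comp_opposite v : v \in V -> comp (opposite v) = comp v.
Proof.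
move=> Vv; symmetry; apply: comp_eq; apply: connect1.
apply: (adj_edge (flow_edge_in Vv)); first exact: flow_edge_end.
by have [_ -> _] := flow_edgeP Vv; rewrite set22.
Qed.

Lemma comp_pair v : v \in V -> comp (on_fst bm_mate v) = comp v.
Proof.
move=> Vv; symmetry; apply: comp_eq; apply: connect1.
apply: (adj_edge (match_edge_in Vv)); first exact: match_edge_end.
by have [_ -> _] := match_edgeP Vv; rewrite set22.
Qed.

Lemma comp_id v : v \in V -> v \in comp v.
Proof. by move=> Vv; rewrite in_comp Vv connect0. Qed.

Lemma edge_component e v K : e \in gm_E C a -> v \in gm_ends e ->
  K \in sg_components G -> (gm_ends e \subset K) = (comp v == K).
Proof.
move=> Ee ve SK; have [Vv _] := edge_at Ee ve.
apply/subsetP/eqP => [/(_ v ve) Kv|<- w we]; first by have [] := component_comp SK Kv.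
have [Vw _] := edge_at Ee we.
by rewrite in_comp Vw; apply/connect1/(adj_edge Ee).
Qed.

Lemma in_edges_in e (K : {set pt * pt}) :
  (e \in @sg_edges_in G K) = (e \in gm_E C a) && (gm_ends e \subset K).
Proof. by rewrite in_set. Qed.

(** Every edge lies in exactly one component. *)
Lemma sum_F : \sum_(K in sg_components G) @sg_F G K =
  \sum_(e in gm_E1 phi a) gm_f e.
Proof.
rewrite (exchange_big_dep (mem (gm_E1 phi a))) /=; last first.
  by move=> K e _ /setIP[].
apply: eq_bigr => e E1; have Ee : e \in gm_E C a by rewrite inE E1.
have [sub c2] := gm_endsP Ee.
have /set0Pn[v ve] : gm_ends e != set0 by rewrite -card_gt0 c2.
rewrite (big_pred1 (comp v)) // => K; apply/andP/eqP => [[SK]|->].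
  by case/setIP=> _; rewrite in_edges_in => /andP[_]; rewrite (edge_component Ee ve SK) => /eqP.
have [Vv _] := edge_at Ee ve.
have SK : comp v \in sg_components G by rewrite sg_componentsE imset_f.
by rewrite SK inE E1 in_edges_in Ee (edge_component Ee ve SK) eqxx.
Qed.

(** A 2-colouring of the vertices directs the edges: intervals towards one
    colour, pairs towards the other. *)
Lemma exists_direction K : K \in sg_components G ->
  exists h, sg_direction (G := G) K h.
Proof.
move=> SK; have [g gP] := exists_alternating mF mP.
have [v0 Kv0] : exists v0, v0 \in K.
  move: SK; rewrite sg_componentsE => /imsetP[v Vv ->].
  by exists v; apply: comp_id.
pose tip (e : gm_edge X) v := (v \in gm_ends e) && (if e is inl _ then g v else ~~ g v).
have tipE e : e \in gm_E C a -> exists v, tip e v.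
  move=> Ee; have [sub c2] := gm_endsP Ee.
  have /set0Pn[v ve] : gm_ends e != set0 by rewrite -card_gt0 c2.
  have [Vv eE] := edge_at Ee ve; have [g1 g2] := gP v Vv.
  have [_ EF _] := flow_edgeP Vv; have [_ EM _] := match_edgeP Vv.
  case: eE => eE.
    case gv : (if e is inl _ then g v else ~~ g v); first by exists v; rewrite /tip ve.
    exists (opposite v); rewrite /tip {1}eE EF set22 /=.
    by move: gv; rewrite g1; case: (e) => _; [move->|move/negbFE->].
  case gv : (if e is inl _ then g v else ~~ g v); first by exists v; rewrite /tip ve.
  exists (on_fst bm_mate v); rewrite /tip {1}eE EM set22 /=.
  by move: gv; rewrite g2; case: (e) => _; [move->|move/negbFE->].
pose h : {ffun gm_edge X -> pt * pt} := [ffun e => odflt v0 [pick v | tip e v]].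
have hP e : e \in gm_E C a -> tip e (h e).
  move=> Ee; rewrite ffunE; case: pickP => //= no.
  by have [v tv] := tipE e Ee; rewrite no in tv.
exists h; apply/andP; split.
  by apply/forall_inP=> e; rewrite in_edges_in => /andP[/hP/andP[]].
apply/dinjectiveP=> e e'; rewrite !in_edges_in => /andP[Ee _] /andP[Ee' _] hh.
have := hP _ Ee; have := hP _ Ee'; rewrite -hh; move: (h e) => v.
have flow_tip u : u \in V -> tip (flow_edge u) u = g u.
  move=> Vu; rewrite /tip flow_edge_end //; have [E1 _ _] := flow_edgeP Vu.
  by case/imsetP: E1 => J _ ->.
have match_tip u : u \in V -> tip (match_edge u) u = ~~ g u.
  by move=> Vu; rewrite /tip match_edge_end.
move=> te' te; have /andP[ve _] := te; have /andP[ve' _] := te'.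
have [Vv eE] := edge_at Ee ve; have [_ eE'] := edge_at Ee' ve'.
case: eE te => -> {ve}; rewrite ?flow_tip ?match_tip // => gv;
by case: eE' te' => -> {ve'}; rewrite ?flow_tip ?match_tip ?gv ?(negbTE gv).
Qed.

Section Direction.
Variables (K : {set pt * pt}) (h : {ffun gm_edge X -> pt * pt}).
Hypotheses (SK : K \in sg_components G) (Kh : sg_direction (G := G) K h).

Lemma flow_edge_K v : v \in K -> flow_edge v \in @sg_edges_in G K.
Proof.
move=> Kv; have [Vv cK] := component_comp SK Kv; rewrite in_edges_in flow_edge_in //=.
by rewrite (edge_component (flow_edge_in Vv) (flow_edge_end Vv)) // cK eqxx.
Qed.

Lemma match_edge_K v : v \in K -> match_edge v \in @sg_edges_in G K.
Proof.
move=> Kv; have [Vv cK] := component_comp SK Kv; rewrite in_edges_in match_edge_in //=.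
by rewrite (edge_component (match_edge_in Vv) (match_edge_end Vv)) // cK eqxx.
Qed.

Lemma K_flow v : v \in K -> opposite v \in K.
Proof.
move=> Kv; have [Vv cK] := component_comp SK Kv.
by rewrite -cK -comp_opposite // comp_id // (mate_in mF).
Qed.

Lemma K_pair v : v \in K -> on_fst bm_mate v \in K.
Proof.
move=> Kv; have [Vv cK] := component_comp SK Kv.
by rewrite -cK -comp_pair // comp_id // (mate_in mP).
Qed.

Lemma head_ends e : e \in @sg_edges_in G K -> h e \in gm_ends e.
Proof. by case/andP: Kh => /forall_inP H _ /H. Qed.

Lemma head_inj : {in @sg_edges_in G K &, injective h}.
Proof. by case/andP: Kh => _ /dinjectiveP. Qed.

Let flow_head := Matching (@opposite X) (fun v => h (flow_edge v) == v).
Let match_head := Matching (on_fst bm_mate) (fun v => h (match_edge v) == v).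

Lemma flow_head_matches : matches K flow_head.
Proof.
move=> v Kv; have [Vv _] := component_comp SK Kv.
split=> /=; [exact: K_flow | exact: (mateK mF) |].
rewrite flow_edge_mate //; have := head_ends (flow_edge_K Kv).
have [_ -> _] := flow_edgeP Vv; have /= n := mate_neq mF Vv.
by case/set2P=> ->; rewrite ?eqxx ?(negbTE n) // eq_sym (negbTE n).
Qed.

Lemma match_head_matches : matches K match_head.
Proof.
move=> v Kv; have [Vv _] := component_comp SK Kv.
split=> /=; [exact: K_pair | exact: (mateK mP) |].
rewrite match_edge_mate //; have := head_ends (match_edge_K Kv).
have [_ -> _] := match_edgeP Vv; have /= n := mate_neq mP Vv.
by case/set2P=> ->; rewrite ?eqxx ?(negbTE n) // eq_sym (negbTE n).
Qed.

(** No vertex of the circle is entered twice, and there are as many edges as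
    vertices, so every vertex is entered exactly once. *)
Lemma head_alternates v : v \in K ->
  (h (flow_edge v) == v) = ~~ (h (match_edge v) == v).
Proof.
move=> Kv; set A := [set u in K | h (flow_edge u) == u].
set B := [set u in K | h (match_edge u) == u].
have dAB : [disjoint A & B].
  rewrite -setI_eq0; apply/eqP/setP=> u; rewrite !inE; apply/negP.
  case/andP=> /andP[Ku /eqP e1] /andP[_ /eqP e2]; have [Vu _] := component_comp SK Ku.
  have /eqP[] := flow_edge_neq Vu.
  by apply: head_inj; rewrite ?flow_edge_K ?match_edge_K // e1 e2.
have cA : #|K| = #|A|.*2.
  have := card_lead (P := predT) flow_head_matches (fun _ _ => erefl).
  rewrite (eq_card (B := mem K)) => [->|u]; last by rewrite inE andbT.
  by congr _.*2; apply: eq_card => u; rewrite !inE andbT.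
have cB : #|K| = #|B|.*2.
  have := card_lead (P := predT) match_head_matches (fun _ _ => erefl).
  rewrite (eq_card (B := mem K)) => [->|u]; last by rewrite inE andbT.
  by congr _.*2; apply: eq_card => u; rewrite !inE andbT.
have : v \in A :|: B.
  suff -> : A :|: B = K by [].
  have AK : A \subset K by apply/subsetP=> u; rewrite inE => /andP[].
  have BK : B \subset K by apply/subsetP=> u; rewrite inE => /andP[].
  apply/eqP; rewrite eqEcard subUset AK BK.
  rewrite cardsU disjoint_setI0 // cards0 subn0.
  by rewrite /= -leq_double doubleD -cA -cB addnn leqnn.
rewrite !inE Kv /=; have := disjointFr dAB (x := v); rewrite !inE Kv /=.
by case: (h (flow_edge v) == v) => [/(_ isT)->|_ /= ->].
Qed.

(** A directed edge points towards the last vertex of its pair; it is directed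
    if and only if the two vertices of the pair have equal signs. *)
Lemma sg_D_direction :
  #|[set e in sg_E2 G :&: @sg_edges_in G K | sg_head (s := G) e == Some (h e)]|%:R =
  \sum_(v in K) (h (match_edge v) == v)%:F * (~~ bm_lead v.1)%:F *
     (gm_s v == gm_s (on_fst bm_mate v))%:F :> 'F_2.
Proof.
pose P v := [&& h (match_edge v) == v, ~~ bm_lead v.1
  & gm_s v == gm_s (on_fst bm_mate v)].
transitivity (#|[set v in K | P v]|%:R : 'F_2); last first.
  by rewrite cardF2; apply: eq_bigr => v _; rewrite /P !andbF2 mulrA.
have headE v : ~~ bm_lead v.1 -> gm_head (match_edge v) = Some v.
  by move=> /negbTE l; rewrite /match_edge l; case: (v).
have signE v : ~~ bm_lead v.1 -> (match_edge v \in gm_E2 C a) =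
    (match_edge v \in gm_Ematch C a) && (gm_s v == gm_s (on_fst bm_mate v)).
  move=> /negbTE l; rewrite in_set; congr (_ && _); rewrite /match_edge l /gm_s /=.
  by rewrite (inj_eq (addIr _)) eq_sym.
congr (_%:R); rewrite -(card_in_imset (f := match_edge) (D := [set v in K | P v])).
  congr #|pred_of_set _|; apply/setP=> e; apply/idP/imsetP.
    rewrite in_set => /andP[/setIP[E2 Ke] /eqP he].
    have Em : e \in gm_Ematch C a by move: E2; rewrite in_set => /andP[].
    have ve := head_ends Ke; have Kv : h e \in K.
      by move: Ke; rewrite in_edges_in => /andP[_ /subsetP]; apply.
    have [Vv _] := component_comp SK Kv; have [_ _ U] := match_edgeP Vv.
    have eE := U e Em ve; exists (h e) => //; rewrite in_set Kv /P -eE eqxx /=.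
    have l : ~~ bm_lead (h e).1.
      apply/negP=> l; move: he (component_comp SK (K_pair Kv)) => he [Vm _].
      have := mate_neq mP Vv; rewrite /= => /eqP[].
      move: he; rewrite {1}eE /match_edge l /= => -[e1].
      by rewrite /on_fst e1; case: (h e).
    by rewrite l /=; move: E2; rewrite {1}eE signE // => /andP[].
  case=> v /setIdP[Kv /and3P[hv l sv]] ->.
  have [Vv _] := component_comp SK Kv; have [Em _ _] := match_edgeP Vv.
  have E2 : match_edge v \in gm_E2 C a by rewrite signE // Em.
  rewrite in_set in_setI match_edge_K // andbT; apply/andP; split=> //.
  by rewrite (eqP hv); apply/eqP; exact: headE.
move=> v w; rewrite !in_set => /andP[_ /and3P[_ lv _]] /andP[_ /and3P[_ lw _]] e.
by have := headE v lv; rewrite e headE // => -[].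
Qed.

End Direction.

(** The directions that [sg_D] picks for the components, glued into one
    2-colouring of the vertices. *)
Definition enters_match v :=
  if [pick h | sg_direction (G := G) (comp v) h] is Some h
  then h (match_edge v) == v else false.

Lemma comp_component v : v \in V -> comp v \in sg_components G.
Proof. by move=> Vv; rewrite sg_componentsE imset_f. Qed.

Lemma enters_match_alternates : {in V, forall v,
  enters_match (opposite v) = ~~ enters_match v /\
  enters_match (on_fst bm_mate v) = ~~ enters_match v}.
Proof.
move=> v Vv; have SK := comp_component Vv; rewrite /enters_match comp_opposite // comp_pair //.
case: pickP => [h Kh|no]; last by have [h Kh] := exists_direction SK; rewrite no in Kh.
have Kv := comp_id Vv; split.
  apply: negb_inj; rewrite -(head_alternates SK Kh (K_flow SK Kv)).
  have /= -> := lead_mate (flow_head_matches SK Kh) Kv.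
  by rewrite (head_alternates SK Kh).
by have /= -> := lead_mate (match_head_matches SK Kh) Kv.
Qed.

Lemma sum_D : \sum_(K in sg_components G) @sg_D G K =
  \sum_(v in V) (enters_match v)%:F * (~~ bm_lead v.1)%:F *
     (gm_s v == gm_s (on_fst bm_mate v))%:F.
Proof.
rewrite (set_partition_big _ component_partition) /=.
apply: eq_bigr => K SK; rewrite /sg_D.
have enE v : v \in K -> enters_match v =
    if [pick h | sg_direction (G := G) K h] is Some h
    then h (match_edge v) == v else false.
  by move=> Kv; have [_ cK] := component_comp SK Kv; rewrite /enters_match cK.
transitivity (\sum_(v in K)
    (if [pick h | sg_direction (G := G) K h] is Some h
     then h (match_edge v) == v else false)%:F * (~~ bm_lead v.1)%:F *
     (gm_s v == gm_s (on_fst bm_mate v))%:F); last first.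
  by apply: eq_bigr => v Kv; rewrite enE.
case: pickP => [h Kh|no]; last by have [h Kh] := exists_direction SK; rewrite no in Kh.
exact: sg_D_direction.
Qed.

(** Compare both orders with those given by the directions of the circles, for
    which the relative sign is the number of circles. What remains is an
    identity between sums over the vertices, and it holds on each pair of C
    separately ([E] below). *)
Lemma sum_circles :
  \sum_(K in sg_components G) (1 + @sg_F G K + @sg_D G K) =
    \sum_(e in gm_E1 phi a) gm_f e
    + rel_sign V flow_matching pair_matching
    + \sum_(v in V) (~~ bm_lead v.1)%:F * gm_s v.
Proof.
pose q := enters_match.
have qP v : v \in V -> q (opposite v) = ~~ q v /\ q (on_fst bm_mate v) = ~~ q v.
  exact: enters_match_alternates.
have mFq : matches V (relead flow_matching q).
  by apply: matches_relead => // v /qP[].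
have mPq : matches V (relead pair_matching (negb \o q)).
  by apply: matches_relead => // v /qP[_ /= ->].
have mPq' : matches V (relead (relead pair_matching (negb \o q)) (lead pair_matching)).
  exact: mP.
rewrite !big_split /= sum_F sum_D.
rewrite (rel_sign_trans mF mFq) // (rel_sign_trans mFq mPq) //.
rewrite (rel_sign_relead mF mFq) (rel_sign_relead mPq mPq').
rewrite (rel_sign_alternating mFq mPq _ (F := comp)); first last.
- move=> v w Vv Vw /setP/(_ w); rewrite !in_comp Vw connect0 /= => vw.
  by have [_] := connect_adj Vv vw.
- exact: comp_pair.
- exact: comp_opposite.
- by [].
have -> : \sum_(K in sg_components G) 1 = #|comp @: V|%:R :> 'F_2.
  by rewrite sumr_const.
have E : \sum_(v in V) (q v)%:F * (~~ bm_lead v.1)%:F *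
     (gm_s v == gm_s (on_fst bm_mate v))%:F =
   \sum_(v in V) ((gm_s v == 0)%:F * (~~ q v)%:F + (~~ q v)%:F * (~~ bm_lead v.1)%:F
     + (~~ bm_lead v.1)%:F * gm_s v).
  rewrite (sum_edges _ mP) [RHS](sum_edges _ mP); apply: eq_bigr => v Vv /=.
  have [_ ->] := qP v Vv; have /= -> := lead_mate mP Vv.
  case: (bm_lead v.1) => /=; first by rewrite !mul0r.
  rewrite !mul1r; move: (gm_s v) (gm_s (on_fst bm_mate v)) => x y.
  by case: (F2P x) => ->; case: (F2P y) => ->; case: (q v); apply/eqP.
rewrite E !big_split /=.
set c := #|_|%:R; set u := \sum_(e in _) _.
set x := \sum_(v in V) _; set y := \sum_(v in V) _; set z := \sum_(v in V) _.
by rewrite [c + u]addrC -!addrA; congr (_ + _); rewrite !addrA [c + x]addrC.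
Qed.

Theorem sq_rel_sign (b : obdeg X (k + 2)) : val b = a ->
  sq C b = \sum_(J : cmp | (fc_csrc J == a) && (fc_ctgt J \in rep_obs phi)) f J
    + rel_sign V flow_matching pair_matching
    + \sum_(v in V) (~~ bm_lead v.1)%:F * gm_s v.
Proof.
move=> ba; rewrite /sq ffunE ba sum_circles -/G !addrA; congr (_ + _ + _).
have inU J : (J \in \bigcup_(c in rep_obs phi) mod1 a c) =
    (fc_csrc J == a) && (fc_ctgt J \in rep_obs phi).
  apply/bigcupP/andP=> [[c cphi]|[/eqP <- cphi]].
    by rewrite inE => /andP[-> /eqP->].
  by exists (fc_ctgt J); rewrite ?inE ?eqxx.
rewrite [RHS](bigID (@is_circle X)) /=; congr (_ + _).
  rewrite -sum1_card natr_sum [RHS]big_mkcond [LHS]big_mkcond /=.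
  apply: eq_bigr => J _; rewrite in_set inU andbA.
  by case: (_ && is_circle J) => /=; first case: (F2P (f J)) => ->.
rewrite big_imset /=; last by move=> J J' _ _ [].
apply: eq_bigl => J; rewrite in_set inU; congr (_ && _).
by rewrite /is_interval /is_circle; case: (fc_bd_card J) => ->.
Qed.

End MatchedGraph.

(** * Points over an object *)

Definition over_matching (Y A : Type) (M : matching Y) : matching (Y * A) :=
  Matching (on_fst (mate M)) (fun v => lead M v.1).

Section Over.
Variables (X : framed_flow1cat) (Y : finType) (src : Y -> fc_ob X) (P : {set Y}).
Notation pt := (fc_pt X).
Variable a : fc_ob X.

(** The common form of the vertices (B, A) and of the corners ((P, B), A), with
    B respectively (P, B) in [P]. *)
Definition points_over : {set Y * pt} :=
  [set v | [&& v.1 \in P, src v.1 == fc_ptgt v.2 & fc_psrc v.2 == a]].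

Definition slice (b : fc_ob X) := [set y in P | src y == b].

Definition preserves (M : matching Y) :=
  matches P M /\ {in P, forall y, src (mate M y) = src y}.

Lemma slice_matches M b : preserves M -> matches (slice b) M.
Proof.
by case=> mM sM y; rewrite !inE => /andP[Py sy]; rewrite sM // sy; have [-> -> ->] := mM y Py.
Qed.

Lemma over_matches M : preserves M -> matches points_over (over_matching pt M).
Proof.
case=> mM sM v; rewrite !inE => /and3P[Pv sv av] /=.
have [Pm mm ml] := mM _ Pv; rewrite /on_fst /= Pm sM // sv av mm ml.
by case: (v).
Qed.

Lemma over_fibre A :
  [set v in points_over | v.2 == A] =
    if fc_psrc A == a then (fun y => (y, A)) @: slice (fc_ptgt A) else set0.
Proof.
apply/setP=> -[y A']; rewrite !inE /=; case: ifP => aA; last first.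
  by case: (eqVneq A' A) => [->|_]; rewrite ?aA ?andbF // inE.
apply/idP/imsetP => [/andP[/and3P[Py sy _] /eqP <-]|[y' ]].
  by exists y => //; rewrite inE Py.
by rewrite inE => /andP[Py sy] [-> ->]; rewrite Py sy aA eqxx.
Qed.

(** Neither matching changes A, and the elements paired with A do not depend on
    [a]. *)
Lemma rel_sign_over M N : preserves M -> preserves N ->
  rel_sign points_over (over_matching pt M) (over_matching pt N) =
  \sum_(A | fc_psrc A == a) rel_sign (slice (fc_ptgt A)) M N.
Proof.
move=> pM pN; rewrite (rel_sign_fibres (F := snd)) //; first last.
- exact: over_matches.
- exact: over_matches.
rewrite [RHS]big_mkcond; apply: eq_bigr => A _; rewrite over_fibre.
case: ifP => // _; last exact: rel_sign_set0.
by apply: rel_sign_transport; try exact: slice_matches; move=> // y y' [].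
Qed.

Lemma sum_over (G : Y -> pt -> 'F_2) :
  \sum_(v in points_over) G v.1 v.2 =
  \sum_(A | fc_psrc A == a) \sum_(y in slice (fc_ptgt A)) G y A.
Proof.
rewrite (partition_big (fun v => v.2) (fun A => fc_psrc A == a)) /=; last first.
  by move=> v; rewrite inE => /and3P[].
apply: eq_bigr => A aA.
transitivity (\sum_(v in [set v in points_over | v.2 == A]) G v.1 v.2).
  by apply: eq_bigl => v; rewrite [in RHS]in_set.
by rewrite over_fibre aA big_imset //= => y y' _ _ [].
Qed.

End Over.

(** * The cocycle condition *)

Lemma sum_frames_over (X : framed_flow1cat) (R : {set fc_ob X}) (a : fc_ob X) :
  \sum_(A | fc_psrc A == a)
    \sum_(J | (fc_csrc J == fc_ptgt A) && (fc_ctgt J \in R)) ffc_f J =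
  \sum_(x : fc_cmp X * fc_pt X | [&& fc_psrc x.2 == a,
      fc_csrc x.1 == fc_ptgt x.2 & fc_ctgt x.1 \in R]) ffc_f x.1.
Proof.
rewrite [RHS](partition_big (fun x => x.2) (fun A => fc_psrc A == a)) /=.
  apply: eq_bigr => A aA; rewrite (reindex_onto (fun J => (J, A)) fst) /=.
    by apply: eq_bigl => J; rewrite aA !eqxx !andbT.
  by move=> [J A'] /= /andP[_ /eqP->].
by move=> x /and3P[].
Qed.

Section SquareAt.
Variables (X : framed_flow1cat) (k : int) (phi : cochain X k).
Variables (C : boundary_matching phi).
Notation pt := (fc_pt X).
Notation cmp := (fc_cmp X).
Notation s := (@ffc_s X).
Notation f := (@ffc_f X).

Definition sq_at (a : fc_ob X) : 'F_2 :=
  \sum_(J : cmp | (fc_csrc J == a) && (fc_ctgt J \in rep_obs phi)) f J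
  + rel_sign (gm_V phi a) (flow_matching X) (pair_matching C)
  + \sum_(v in gm_V phi a) (~~ bm_lead C v.1)%:F * gm_s v.

Lemma sq_atE (b : obdeg X (k + 2)) : sq C b = sq_at (val b).
Proof. exact: sq_rel_sign. Qed.

Lemma rep_obs_gr c : c \in rep_obs phi -> fc_gr c = k.
Proof. by case/imsetP=> -[o /= /eqP go] _ ->. Qed.

(** On the corners of the M(d, c_j), with p, b, a the signs of the three points,
    the steps
    I x {A} (ordered by p + b), I x {A} (ordered by p + b + a),
    {P} x J (ordered by p + b + a), {P} x J (ordered by b + a), C
    connect the two matchings, and the compatibility condition is the second
    step. The framings of the {P} x J cancel since C pairs the points P. *)
Theorem sq_at_cocycle d : fc_gr d = k + 3 ->
  \sum_(A : pt | fc_psrc A == d) sq_at (fc_ptgt A) = 0.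
Proof.
move=> gd; pose R := rep_obs phi; pose V := cornerset R d.
pose P : {set pt * pt} := [set w | (fc_ptgt w.1 \in R) && composable w].
pose src (w : pt * pt) := fc_psrc w.2.
have overE : points_over src P d = V.
  by apply/setP=> -[w A]; rewrite !inE -!andbA.
have sliceE b : slice src P b = gm_V phi b.
  by apply/setP=> w; rewrite mem_gm_V inE inE -andbA.
have PP w : w \in P -> w \in gm_V phi (src w).
  by rewrite inE => /andP[tw cw]; rewrite mem_gm_V; apply/and3P.
have preP M : (forall a, matches (gm_V phi a) M) -> preserves src P M.
  move=> mM; split=> w /PP Vw; have [Vm mm ml] := mM _ _ Vw.
    by split=> //; move: Vm; rewrite mem_gm_V inE => /and3P[tw cw _]; apply/andP.
  by move: Vm; rewrite mem_gm_V => /and3P[_ _ /eqP].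
have pF : preserves src P (flow_matching X) by apply: preP; apply: flow_matches.
have pC : preserves src P (pair_matching C) by apply: preP; apply: pair_matches.
have mT : matches V (over_matching pt (pair_matching C)).
  by rewrite -overE; apply: over_matches.
have mS : matches V (over_matching pt (flow_matching X)).
  by rewrite -overE; apply: over_matches.
pose U := upper (X := X) (fun v => sign3 v == 0).
pose L := lower (X := X) (fun v => sign3 v == 1).
pose L0 := lower (X := X) (fun v => sign2 v == 0).
have mU : matches V U by apply: upper_sign_matches.
have mL : matches V L by apply: lower_sign_matches.
have mL0 : matches V L0.
  by apply: lower_matches => v; rewrite inE => /and4P[_ _ /lower_oppositeP[_ -> _ _ _] _];
    rewrite F2_eq0_flip.
rewrite !big_split /=.
have -> : \sum_(A | fc_psrc A == d) rel_sign (gm_V phi (fc_ptgt A))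
    (flow_matching X) (pair_matching C) =
    rel_sign V (over_matching pt (flow_matching X))
      (over_matching pt (pair_matching C)).
  rewrite -overE rel_sign_over //.
  by apply: eq_bigr => A _; rewrite sliceE.
have -> : \sum_(A | fc_psrc A == d) \sum_(v in gm_V phi (fc_ptgt A))
    (~~ bm_lead C v.1)%:F * gm_s v =
    \sum_(v in V) (~~ bm_lead C v.1.1)%:F * gm_s v.1.
  rewrite -overE (sum_over _ _ _ (fun w (A : pt) => (~~ bm_lead C w.1)%:F * gm_s w : 'F_2)).
  by apply: eq_bigr => A _; rewrite sliceE.
have -> : \sum_(A | fc_psrc A == d)
    \sum_(J : cmp | (fc_csrc J == fc_ptgt A) && (fc_ctgt J \in rep_obs phi)) f J =
    \sum_(x : cmp * pt | [&& fc_psrc x.2 == d, fc_csrc x.1 == fc_ptgt x.2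
        & fc_ctgt x.1 \in R]) f x.1.
  exact: sum_frames_over.
rewrite (rel_sign_trans mS mU) // (rel_sign_trans mU mL) //.
rewrite (rel_sign_trans mL mL0) //.
rewrite (rel_sign_relead mS mU) (rel_sign_relead mL mL0).
rewrite compatibility_rel_sign => [|c /rep_obs_gr gc]; last by rewrite gd gc.
have -> : \sum_(x : pt * cmp | [&& fc_csrc x.2 == d, fc_psrc x.1 == fc_ctgt x.2
        & fc_ptgt x.1 \in R]) f x.2 = 0.
  pose W := [set x : pt * cmp | [&& fc_csrc x.2 == d, fc_psrc x.1 == fc_ctgt x.2
        & fc_ptgt x.1 \in R]].
  transitivity (\sum_(x in W) f x.2); first by apply: eq_bigl => x; rewrite in_set.
  apply: (sum_mate0 (M := Matching (on_fst (bm_mate C)) (fun x => bm_lead C x.1))) => //.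
  move=> [B J]; rewrite !inE /= => /and3P[-> sB tB].
  have PB : B \in phi_points phi by rewrite inE.
  have [tm mm ml] := bm_matches C PB; rewrite inE in tm.
  by rewrite /= in mm tm ml *; rewrite /on_fst /= bm_src // sB tm mm.
have comm : {in V, forall v, mate L0 (mate (over_matching pt (pair_matching C)) v) =
    mate (over_matching pt (pair_matching C)) (mate L0 v)} by [].
rewrite (rel_sign_commuting mL0 mT comm) //.
rewrite addr0.
set z := \sum_(x : cmp * pt | _) _.
have Z1 : \sum_(v in V) (1 + s v.1.1) = 0 by apply: (sum_mate0 mL).
have Z2 : \sum_(v in V) (~~ bm_lead C v.1.1)%:F * s v.1.1 = 0.
  by apply: (sum_mate0 mL).
have Z3 : \sum_(v in V) (gm_s v.1 == 0)%:F * s v.2 =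
    \sum_(v in V) (bm_lead C v.1.1)%:F * s v.2.
  exact: (sum_lead (G := fun v => s v.2) mS mT).
have Z4 : \sum_(v in V) s v.2 = 0 by apply: (sum_mate0 mS).
have E : \sum_(v in V) (1 + s v.1.1) + \sum_(v in V) (~~ bm_lead C v.1.1)%:F * s v.1.1
    + (\sum_(v in V) (gm_s v.1 == 0)%:F * s v.2
       + \sum_(v in V) (bm_lead C v.1.1)%:F * s v.2)
    + \sum_(v in V) s v.2 = 0.
  by rewrite Z1 Z2 Z3 Z4 !addr0 add0r addF2.
have cancel_z (t u1 u2 u3 u4 u5 : 'F_2) : u1 + u2 + u3 + u4 + u5 = 0 ->
    t + (u1 + (t + u2 + (u3 + u4))) + u5 = 0.
  move=> u0; rewrite -[RHS]u0 addrA [t + u1]addrC -!addrA; congr (_ + _).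
  by rewrite addrA addF2 add0r.
apply: cancel_z; rewrite -[RHS]E -!big_split; apply: eq_bigr => v _ /=.
rewrite /sign3 /sign2 /gm_s /=.
move: (s v.1.1) (s v.1.2) (s v.2) (bm_lead C v.1.1) => p b a l.
by case: (F2P p) => ->; case: (F2P b) => ->; case: (F2P a) => ->; case: l; apply/eqP.
Qed.
End SquareAt.

(** * Families of objects *)

Section Families.
Variable X : framed_flow1cat.
Notation Ob := (fc_ob X).
Notation pt := (fc_pt X).
Notation cmp := (fc_cmp X).
Notation s := (@ffc_s X).
Notation f := (@ffc_f X).

Section Points.
Variables (I : finType) (x : I -> Ob) (R : {set I}).

Definition fam_points : {set I * pt} :=
  [set y | (y.1 \in R) && (fc_ptgt y.2 == x y.1)].

Definition fam_src (y : I * pt) := fc_psrc y.2.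

Definition fam_verts a := points_over fam_src fam_points a.

Lemma fam_vertsE a v : (v \in fam_verts a) =
  [&& v.1.1 \in R, fc_ptgt v.1.2 == x v.1.1, composable (v.1.2, v.2)
    & fc_psrc v.2 == a].
Proof. by rewrite !inE -!andbA. Qed.

Definition fam_flow : matching (I * pt * pt) :=
  Matching (@lower_opposite X I) (fun v => sign2 v == 0).

Lemma fam_flow_matches a : matches (fam_verts a) fam_flow.
Proof.
move=> v; rewrite fam_vertsE => /and4P[Rv tv cv av].
have [oo e1 e2 e3 e4] := lower_oppositeP cv; split=> //=; last first.
  by rewrite e1 F2_eq0_flip.
by rewrite fam_vertsE Rv e2 tv e4 e3.
Qed.

Variable M : matching (I * pt).

(** The formula of [sq_rel_sign], with the objects c_j replaced by the x i for
    i in [R]; indices keep repeated objects apart. *)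
Definition fam_sq (a : Ob) : 'F_2 :=
  \sum_(i in R) \sum_(J | (fc_csrc J == a) && (fc_ctgt J == x i)) f J
  + rel_sign (fam_verts a) fam_flow (over_matching pt M)
  + \sum_(v in fam_verts a) (~~ lead M v.1)%:F * sign2 v.

Definition fam_matching := preserves fam_src fam_points M.

End Points.

(** Modulo 2 the incidence number [a : b] is the number of points of M(a, b). *)
Definition is_coboundary (n : int) (u : Ob -> 'F_2) := exists g : Ob -> 'F_2,
  forall a, fc_gr a = n -> u a = \sum_(A : pt | fc_psrc A == a) g (fc_ptgt A).

Lemma is_coboundaryD n u v : is_coboundary n u -> is_coboundary n v ->
  is_coboundary n (fun a => u a + v a).
Proof.
move=> [g gP] [h hP]; exists (fun b => g b + h b) => a na.
by rewrite gP // hP // big_split.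
Qed.

Lemma eq_is_coboundary n u v : (forall a, fc_gr a = n -> u a = v a) ->
  is_coboundary n v -> is_coboundary n u.
Proof. by move=> uv [g gP]; exists g => a na; rewrite uv // gP. Qed.

(** The intervals cancel between the two cochains. The rest splits over the
    points A of M(a, b); the sign of A enters both cochains the same number of
    times, namely once for each pair. *)
Lemma fam_sq_matching (I : finType) (x : I -> Ob) (R : {set I})
    (M N : matching (I * pt)) n : fam_matching x R M -> fam_matching x R N ->
  is_coboundary n (fun a => fam_sq x R M a + fam_sq x R N a).
Proof.
move=> okM okN; pose S b := slice (@fam_src I) (fam_points x R) b.
exists (fun b => rel_sign (S b) M N
  + \sum_(y in S b) ((~~ lead M y)%:F + (~~ lead N y)%:F) * s y.2) => a _.
have mM : matches (fam_verts x R a) (over_matching pt M) by apply: over_matches.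
have mN : matches (fam_verts x R a) (over_matching pt N) by apply: over_matches.
have mF := @fam_flow_matches _ x R a.
rewrite big_split /= -rel_sign_over //.
rewrite -(sum_over (@fam_src I) (fam_points x R) a
  (fun y A => ((~~ lead M y)%:F + (~~ lead N y)%:F) * s y.2)).
rewrite (rel_sign_trans mM mF mN) (rel_signC mM mF) /fam_sq.
have E : \sum_(v in fam_verts x R a) (~~ lead M v.1)%:F * sign2 v
    + \sum_(v in fam_verts x R a) (~~ lead N v.1)%:F * sign2 v =
   \sum_(v in fam_verts x R a) ((~~ lead M v.1)%:F + (~~ lead N v.1)%:F) * s v.1.2.
  have := sum_lead (G := fun v => s v.2) mM mN (fun _ _ => erefl) (fun _ _ => erefl).
  move=> /= e; rewrite -[RHS]addr0.
  rewrite -[X in _ = _ + X](addF2 (\sum_(v in fam_verts x R a) (lead M v.1)%:F * s v.2)).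
  rewrite {2}e -!big_split; apply: eq_bigr => v _ /=; rewrite /sign2 /gm_s /=.
  move: (s v.1.2) (s v.2) => b c.
  by case: (F2P b) => ->; case: (F2P c) => ->; case: (lead M v.1);
    case: (lead N v.1); apply/eqP.
by rewrite -E addrACA [X in X + _]addrACA addF2 add0r.
Qed.

Section Sum.
Variables (I1 I2 : finType) (x1 : I1 -> Ob) (x2 : I2 -> Ob).
Variables (R1 : {set I1}) (R2 : {set I2}).
Variables (M1 : matching (I1 * pt)) (M2 : matching (I2 * pt)).
Hypotheses (ok1 : fam_matching x1 R1 M1) (ok2 : fam_matching x2 R2 M2).

Definition sum_ob (i : I1 + I2) := match i with inl i => x1 i | inr i => x2 i end.

Definition sum_set : {set I1 + I2} :=
  [set i | match i with inl i => i \in R1 | inr i => i \in R2 end].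

Definition sum_matching : matching ((I1 + I2) * pt) := Matching
  (fun y => match y.1 with
            | inl i => let z := mate M1 (i, y.2) in (inl z.1, z.2)
            | inr i => let z := mate M2 (i, y.2) in (inr z.1, z.2)
            end)
  (fun y => match y.1 with
            | inl i => lead M1 (i, y.2)
            | inr i => lead M2 (i, y.2)
            end).

Lemma sum_family_matching : fam_matching sum_ob sum_set sum_matching.
Proof.
case: ok1 => m1 s1; case: ok2 => m2 s2.
split=> -[[i|i] B]; rewrite inE /= inE => iB.
- have [] := m1 (i, B); first by rewrite inE.
  case: (mate M1 (i, B)) => i' B'; rewrite inE /= => ? -> ->; split=> //.
  by rewrite inE /= inE.
- have [] := m2 (i, B); first by rewrite inE.
  case: (mate M2 (i, B)) => i' B'; rewrite inE /= => ? -> ->; split=> //.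
  by rewrite inE /= inE.
- by apply: (s1 (i, B)); rewrite inE.
- by apply: (s2 (i, B)); rewrite inE.
Qed.

Let in1 (v : I1 * pt * pt) : (I1 + I2) * pt * pt := (inl v.1.1, v.1.2, v.2).
Let in2 (v : I2 * pt * pt) : (I1 + I2) * pt * pt := (inr v.1.1, v.1.2, v.2).

Lemma sum_verts a : fam_verts sum_ob sum_set a =
  (in1 @: fam_verts x1 R1 a) :|: (in2 @: fam_verts x2 R2 a).
Proof.
apply/setP=> -[[[i|i] B] A]; rewrite in_setU fam_vertsE /= inE.
  apply/idP/orP => [H|[/imsetP[v]|/imsetP[v _ []//]]].
    by left; apply/imsetP; exists (i, B, A); rewrite ?fam_vertsE.
  by rewrite fam_vertsE => H [-> -> ->].
apply/idP/orP => [H|[/imsetP[v _ []//]|/imsetP[v]]].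
  by right; apply/imsetP; exists (i, B, A); rewrite ?fam_vertsE.
by rewrite fam_vertsE => H [-> -> ->].
Qed.

Lemma fam_sq_sum a :
  fam_sq sum_ob sum_set sum_matching a = fam_sq x1 R1 M1 a + fam_sq x2 R2 M2 a.
Proof.
have i1 : injective in1 by move=> [[i B] A] [[i' B'] A'] [-> -> ->].
have i2 : injective in2 by move=> [[i B] A] [[i' B'] A'] [-> -> ->].
have d12 : [disjoint in1 @: fam_verts x1 R1 a & in2 @: fam_verts x2 R2 a].
  rewrite -setI_eq0; apply/eqP/setP=> v; rewrite !inE; apply/negP.
  by case/andP=> /imsetP[v1 _ ->] /imsetP[v2 _ []].
have mF1 := @fam_flow_matches _ x1 R1 a; have mF2 := @fam_flow_matches _ x2 R2 a.
have mM1 : matches (fam_verts x1 R1 a) (over_matching pt M1) by apply: over_matches.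
have mM2 : matches (fam_verts x2 R2 a) (over_matching pt M2) by apply: over_matches.
have tF1 : transports in1 (fam_verts x1 R1 a) (fam_flow I1) (fam_flow (I1 + I2)%type).
  by [].
have tF2 : transports in2 (fam_verts x2 R2 a) (fam_flow I2) (fam_flow (I1 + I2)%type).
  by [].
have tM1 : transports in1 (fam_verts x1 R1 a) (over_matching pt M1)
    (over_matching pt sum_matching).
  by move=> [[i B] A] _; rewrite /on_fst /=; case: (mate M1 (i, B)).
have tM2 : transports in2 (fam_verts x2 R2 a) (over_matching pt M2)
    (over_matching pt sum_matching).
  by move=> [[i B] A] _; rewrite /on_fst /=; case: (mate M2 (i, B)).
rewrite /fam_sq sum_verts rel_signU //; first last.
- exact: transports_matches mM2 tM2.
- exact: transports_matches mF2 tF2.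
- exact: transports_matches mM1 tM1.
- exact: transports_matches mF1 tF1.
rewrite !(rel_sign_transport _ _ _ tF1 tM1) //.
rewrite !(rel_sign_transport _ _ _ tF2 tM2) //.
rewrite [X in _ + X](_ : _ =
   \sum_(v in fam_verts x1 R1 a) (~~ lead M1 v.1)%:F * sign2 v
   + \sum_(v in fam_verts x2 R2 a) (~~ lead M2 v.1)%:F * sign2 v); last first.
  rewrite (eq_bigl (mem [predU in1 @: fam_verts x1 R1 a
    & in2 @: fam_verts x2 R2 a])) => [|v]; last by rewrite /= in_setU.
  rewrite bigU //=; congr (_ + _).
    by rewrite big_imset => [|v w _ _]; [apply: eq_bigr => -[[]]|apply: i1].
  by rewrite big_imset => [|v w _ _]; [apply: eq_bigr => -[[]]|apply: i2].
rewrite [X in X + _ + _](_ : _ =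
   \sum_(i in R1) \sum_(J | (fc_csrc J == a) && (fc_ctgt J == x1 i)) f J
   + \sum_(i in R2) \sum_(J | (fc_csrc J == a) && (fc_ctgt J == x2 i)) f J).
  by rewrite [X in X + _]addrACA [LHS]addrACA.
by rewrite big_sumType /=; congr (_ + _); apply: eq_bigl => i; rewrite inE.
Qed.

End Sum.

Section OfMatching.
Variables (k : int) (phi : cochain X k) (C : boundary_matching phi).

Definition bm_family : matching (Ob * pt) := Matching
  (fun y => let B := bm_mate C y.2 in (fc_ptgt B, B)) (fun y => bm_lead C y.2).

Lemma bm_family_matching : fam_matching id (rep_obs phi) bm_family.
Proof.
split=> -[c B]; rewrite inE /= => /andP[cphi /eqP Bc].
  have [] := @bm_matches _ _ _ C B; first by rewrite inE Bc.
  by rewrite /= inE => tm mm ->; rewrite inE /= tm eqxx mm Bc.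
by apply: bm_src; rewrite inE Bc.
Qed.

Lemma fam_sq_bm a : fam_sq id (rep_obs phi) bm_family a = sq_at C a.
Proof.
pose i (w : pt * pt) := (fc_ptgt w.1, w.1, w.2).
have i_inj : injective i by move=> [B A] [B' A'] [_ -> ->].
have vertsE : fam_verts id (rep_obs phi) a = i @: gm_V phi a.
  apply/setP=> -[[c B] A]; rewrite fam_vertsE /=; apply/and4P/imsetP.
    move=> [cphi /eqP tB cB aA]; exists (B, A); rewrite /i /= ?tB //.
    by rewrite mem_gm_V /= tB cphi aA andbT.
  by move=> [[B' A'] V' [-> -> ->]]; move: V'; rewrite mem_gm_V => /and3P[].
have mF := @flow_matches _ _ phi a; have mP := @pair_matches _ _ _ C a.
have tF : transports i (gm_V phi a) (flow_matching X) (fam_flow Ob).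
  move=> [B A]; rewrite mem_gm_V => /and3P[_ cB _]; split=> //.
  have [_ _ e _ _] := oppositeP cB; rewrite /= /lower_opposite /i /=.
  by move: e => /= <-.
have tP : transports i (gm_V phi a) (pair_matching C) (over_matching pt bm_family).
  by [].
rewrite /fam_sq vertsE (rel_sign_transport i_inj mF mP tF tP) /sq_at.
rewrite [X in _ + X]big_imset; last by move=> v w _ _; apply: i_inj.
congr (_ + _ + _).
rewrite [RHS](partition_big (@fc_ctgt X) (mem (rep_obs phi))) /=; last first.
  by move=> J /andP[].
apply: eq_bigr => c cphi; apply: eq_bigl => J.
by case: (eqVneq (fc_ctgt J) c) => [->|_]; rewrite ?andbF // cphi !andbT.
Qed.

End OfMatching.

Section Even.
Variables (I : finType) (x : I -> Ob) (R : {set I}).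
Hypothesis evenR : {in R, forall i, ~~ odd #|[set j in R | x j == x i]|}.

Let pi : matching I := pairing x R.

Definition even_matching : matching (I * pt) := over_matching pt pi.

Let mpi : matches R pi := pairing_matches evenR.
Let xpi i : i \in R -> x (mate pi i) = x i := @pairing_fibre _ _ _ _ evenR i.

Lemma even_family_matching : fam_matching x R even_matching.
Proof.
split=> // -[i B]; rewrite inE /= => /andP[Ri tB].
have [Rm mm ml] := mpi Ri; split; last exact: ml.
  by rewrite inE [_.1]/= [_.2]/= Rm xpi.
exact: (congr1 (fun j => (j, B)) mm).
Qed.

(** The framing of each interval occurs twice, and the pairing of the indices
    commutes with the intervals, so all circles have length four. *)
Lemma fam_sq_even a : fam_sq x R even_matching a = 0.
Proof.
have mF := @fam_flow_matches _ x R a.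
have mE : matches (fam_verts x R a) (over_matching pt even_matching).
  by apply: over_matches; apply: even_family_matching.
rewrite /fam_sq (rel_sign_commuting mF mE) //.
rewrite (sum_mate0 (G := fun i => \sum_(J | (fc_csrc J == a) && (fc_ctgt J == x i)) f J) mpi).
  rewrite add0r -big_split big1 // => v _ /=.
  by rewrite negbF2 eq0F2 addrA addF2 add0r mulrC addF2.
by move=> i Ri; rewrite xpi.
Qed.

End Even.

(** Compare with the matching that pairs equal objects, whose cochain is 0. *)
Theorem fam_sq_coboundary (I : finType) (x : I -> Ob) (R : {set I})
    (M : matching (I * pt)) n :
    {in R, forall i, ~~ odd #|[set j in R | x j == x i]|} -> fam_matching x R M ->
  is_coboundary n (fam_sq x R M).
Proof.
move=> evenR okM.
apply: eq_is_coboundary (fam_sq_matching n okM (even_family_matching evenR)) => a _.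
by rewrite fam_sq_even // addr0.
Qed.

Section Boundary.
Variables (j : int) (theta : cochain X j).

(** The points P ending in an object of theta, standing for their sources; a
    point B that ends in the source of P is the corner (P, B) of an interval. *)
Definition delta_family : {set pt} := [set P | fc_ptgt P \in rep_obs theta].

Definition delta_matching : matching (pt * pt) :=
  Matching (@opposite X) (fun w => gm_s w == 1).

Lemma delta_verts a :
  fam_verts (@fc_psrc X) delta_family a = cornerset (rep_obs theta) a.
Proof.
apply/setP=> v; rewrite fam_vertsE !inE /composable /=.
by rewrite [fc_ptgt v.1.2 == _]eq_sym.
Qed.

Lemma delta_family_matching : fam_matching (@fc_psrc X) delta_family delta_matching.
Proof.
split=> w; rewrite inE inE => /andP[tw cw].
  have cw' : composable w by rewrite /composable eq_sym.
  have [co oo e1 e2 e3] := oppositeP cw'; split=> //=.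
    by rewrite inE inE e1 tw eq_sym.
  by rewrite e3 F2_eq1_flip.
have cw' : composable w by rewrite /composable eq_sym.
by have [_ _ _ e _] := oppositeP cw'.
Qed.

(** On triples ((P, B), A) the intervals of the family are the {P} x J and the
    matching is by the I x {A}, so the relative sign is the one of the
    compatibility condition up to the orders of the edges. *)
Theorem delta_sq_coboundary :
  is_coboundary (j + 3) (fam_sq (@fc_psrc X) delta_family delta_matching).
Proof.
pose P : {set pt * pt} :=
  [set w | (fc_ptgt w.1 \in rep_obs theta) && composable w].
pose src (w : pt * pt) := fc_psrc w.2.
exists (fun b => \sum_(J : cmp | (fc_csrc J == b) && (fc_ctgt J \in rep_obs theta)) f J
  + \sum_(w in slice src P b) (1 + gm_s w) * (1 + s w.2)) => a ga.
pose V := cornerset (rep_obs theta) a.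
have overE : points_over src P a = V.
  by apply/setP=> -[w A]; rewrite !inE -!andbA.
rewrite big_split /= -(sum_over src P a (fun w (A : pt) => (1 + gm_s w) * (1 + s w.2) : 'F_2)).
rewrite overE.
have -> : \sum_(A | fc_psrc A == a)
    \sum_(J : cmp | (fc_csrc J == fc_ptgt A) && (fc_ctgt J \in rep_obs theta)) f J =
    \sum_(x : cmp * pt | [&& fc_psrc x.2 == a, fc_csrc x.1 == fc_ptgt x.2
        & fc_ctgt x.1 \in rep_obs theta]) f x.1.
  exact: sum_frames_over.
pose U := upper (X := X) (fun v => sign3 v == 0).
pose L := lower (X := X) (fun v => sign3 v == 1).
have mU : matches V U by apply: upper_sign_matches.
have mL : matches V L by apply: lower_sign_matches.
have mF : matches V (fam_flow pt) by rewrite /V -delta_verts; apply: fam_flow_matches.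
have mM : matches V (over_matching pt delta_matching).
  by rewrite /V -delta_verts; apply: over_matches; apply: delta_family_matching.
rewrite /fam_sq delta_verts (rel_sign_trans mF mL) // (rel_sign_trans mL mU) //.
rewrite (rel_sign_relead mF mL) (rel_sign_relead mU mM) (rel_signC mL mU).
rewrite compatibility_rel_sign => [|c /rep_obs_gr gc]; last by rewrite ga gc.
have -> : \sum_(P in delta_family)
    \sum_(J | (fc_csrc J == a) && (fc_ctgt J == fc_psrc P)) f J =
    \sum_(x : pt * cmp | [&& fc_csrc x.2 == a, fc_psrc x.1 == fc_ctgt x.2
        & fc_ptgt x.1 \in rep_obs theta]) f x.2.
  rewrite pair_big_dep /=; apply: eq_bigl => -[B J] /=.
  by rewrite inE eq_sym andbC -andbA [_ == fc_ctgt J]eq_sym.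
set y := \sum_(x : pt * cmp | _) _; set z := \sum_(x : cmp * pt | _) _.
have cancel_y (t t' u1 u2 u3 u4 u5 : 'F_2) : u1 + u2 + u3 + u4 = u5 ->
    t + (u1 + (t' + t + u2 + u3)) + u4 = t' + u5.
  move=> <-; rewrite addrA [t' + t]addrC -!addrA [u1 + (t + _)]addrCA.
  by rewrite addrA addF2 add0r addrCA.
apply: cancel_y; rewrite -!big_split; apply: eq_bigr => v _ /=.
rewrite /sign3 /sign2 /gm_s /=.
move: (s v.1.1) (s v.1.2) (s v.2) => p b c.
by case: (F2P p) => ->; case: (F2P b) => ->; case: (F2P c) => ->; apply/eqP.
Qed.

End Boundary.
End Families.

(** * Cohomology classes *)

Section CohomologyClasses.
Variable X : framed_flow1cat.
Notation Ob := (fc_ob X).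
Notation pt := (fc_pt X).

Lemma mem_rep_obs k (phi : cochain X k) (b : obdeg X k) :
  phi b = (val b \in rep_obs phi)%:F.
Proof.
rewrite mem_imset; last exact: val_inj.
by rewrite inE eq1F2.
Qed.

Lemma incidence_mod2 (a b : Ob) : (incidence a b)%:~R = #|mod0 a b|%:R :> 'F_2.
Proof.
rewrite /incidence rmorph_sum -sum1_card natr_sum; apply: eq_bigr => A _.
rewrite rmorphXn /= rmorphN1 (_ : -1 = 1 :> 'F_2) ?expr1n //.
by apply/eqP.
Qed.

Lemma coboundaryE j k (phi : cochain X j) (g : Ob -> 'F_2) (a : obdeg X k) :
    k = j + 1 -> (forall b, phi b = g (val b)) ->
  coboundary k phi a = \sum_(A : pt | fc_psrc A == val a) g (fc_ptgt A).
Proof.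
move=> kj phig; rewrite ffunE.
transitivity (\sum_(b : obdeg X j)
    \sum_(A : pt | (fc_psrc A == val a) && (fc_ptgt A == val b)) g (fc_ptgt A)).
  apply: eq_bigr => b _; rewrite incidence_mod2 phig -sum1_card natr_sum mulr_suml.
  apply: eq_big => [A|A]; first by rewrite inE.
  by rewrite inE mul1r => /andP[_ /eqP->].
rewrite (exchange_big_dep (fun A => fc_psrc A == val a)) /=; last first.
  by move=> b A _ /andP[].
apply: eq_bigr => A aA; have gA : fc_gr (fc_ptgt A) == j.
  have := fc_pt_gr A; rewrite (eqP aA) (eqP (valP a)) kj => /addIr->.
  by rewrite eqxx.
rewrite (big_pred1 (Sub (fc_ptgt A) gA : obdeg X j)) // => b.
by rewrite /= aA; apply/eqP/eqP => [e|->//]; apply: val_inj.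
Qed.

Lemma cocycleP k (phi : cochain X k) :
  reflect (coboundary (k + 1) phi = 0) (phi \in cocycles X k).
Proof. by rewrite memv_ker lfunE; apply: eqP. Qed.

Lemma sq_cocycle k (phi : cochain X k) (C : boundary_matching phi) :
  sq C \in cocycles X (k + 2).
Proof.
apply/cocycleP/ffunP => d; rewrite (coboundaryE _ (g := sq_at C)) //.
  rewrite sq_at_cocycle ?ffunE //; rewrite (eqP (valP d)) -addrA.
  by [].
exact: sq_atE.
Qed.

Lemma is_coboundary_mem k (u : Ob -> 'F_2) (v : cochain X k) :
  is_coboundary (X := X) k u -> (forall b, v b = u (val b)) -> v \in coboundaries X k.
Proof.
case=> g gP vu; have -> : v = linfun (@coboundary X (k - 1) k) [ffun b => g (val b)].
  apply/ffunP=> a; rewrite lfunE (coboundaryE _ (g := g)) ?subrK // => [|b].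
    by rewrite vu gP // (eqP (valP a)).
  by rewrite ffunE.
exact: memv_img (memvf _).
Qed.

Lemma coboundariesP k (phi : cochain X k) : phi \in coboundaries X k ->
  exists theta : cochain X (k - 1), phi = coboundary k theta.
Proof. by case/memv_imgP=> theta _ ->; exists theta; rewrite lfunE. Qed.

Definition multiplicity (I : finType) (x : I -> Ob) (R : {set I}) (o : Ob) : 'F_2 :=
  \sum_(i in R) (x i == o)%:F.

Lemma multiplicity_sum (I1 I2 : finType) (x1 : I1 -> Ob) (x2 : I2 -> Ob)
    (R1 : {set I1}) (R2 : {set I2}) o :
  multiplicity (sum_ob x1 x2) (sum_set R1 R2) o =
  multiplicity x1 R1 o + multiplicity x2 R2 o.
Proof.
rewrite /multiplicity big_sumType /=.
by congr (_ + _); apply: eq_bigl => i; rewrite inE.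
Qed.

Lemma multiplicity_rep k (phi : cochain X k) o :
  multiplicity id (rep_obs phi) o = (o \in rep_obs phi)%:F.
Proof.
rewrite /multiplicity; case: (boolP (o \in _)) => oR.
  rewrite (bigD1 o) //= eqxx big1 ?addr0 // => c /andP[_ /negbTE->] //.
by rewrite big1 // => c cR; case: eqP => // co; rewrite -co cR in oR.
Qed.

Theorem sq_triple k (phi psi chi : cochain X k) (C1 : boundary_matching phi)
    (C2 : boundary_matching psi) (C3 : boundary_matching chi) :
  phi + psi + chi \in coboundaries X k ->
  sq C1 + sq C2 + sq C3 \in coboundaries X (k + 2).
Proof.
case/coboundariesP=> theta bd.
apply: (is_coboundary_mem (u := fun a => sq_at C1 a + sq_at C2 a + sq_at C3 a));
  last by move=> b; rewrite !ffunE -!sq_atE !ffunE.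
have ok1 := bm_family_matching C1; have ok2 := bm_family_matching C2.
have ok3 := bm_family_matching C3; have ok4 := delta_family_matching theta.
have ok12 := sum_family_matching ok1 ok2; have ok123 := sum_family_matching ok12 ok3.
have ok := sum_family_matching ok123 ok4.
have bdp : is_coboundary (k + 2) (fam_sq (@fc_psrc X) (delta_family theta) (@delta_matching X)).
  by have := delta_sq_coboundary theta; rewrite -addrA.
suff ev : {in sum_set (sum_set (sum_set (rep_obs phi) (rep_obs psi)) (rep_obs chi))
    (delta_family theta), forall i, ~~ odd #|[set j in
    sum_set (sum_set (sum_set (rep_obs phi) (rep_obs psi)) (rep_obs chi))
    (delta_family theta) | sum_ob (sum_ob (sum_ob id id) id) (@fc_psrc X) j
      == sum_ob (sum_ob (sum_ob id id) id) (@fc_psrc X) i]|}.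
  have := is_coboundaryD (fam_sq_coboundary (k + 2) ev ok) bdp.
  apply: eq_is_coboundary => a _.
  by rewrite !fam_sq_sum // !fam_sq_bm -[RHS]addrA addF2 addr0.
move=> i _; set o := sum_ob _ _ i.
suff : multiplicity (sum_ob (sum_ob (sum_ob id id) id) (@fc_psrc X))
    (sum_set (sum_set (sum_set (rep_obs phi) (rep_obs psi)) (rep_obs chi))
    (delta_family theta)) o = 0.
  rewrite /multiplicity -cardF2 -oddF2; by case: (odd _).
rewrite !multiplicity_sum !multiplicity_rep.
case: (boolP (fc_gr o == k)) => [ok_o|no].
  pose b : obdeg X k := Sub o ok_o.
  have := coboundaryE b (g := fun c => (c \in rep_obs theta)%:F)
    (esym (subrK 1 k)) (mem_rep_obs theta).
  rewrite -bd !ffunE !mem_rep_obs SubK => ->.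
  rewrite /multiplicity big_mkcond [X in _ + X]big_mkcond -big_split big1 // => P _ /=.
  by rewrite inE; case: (fc_ptgt P \in _); case: (fc_psrc P == o); apply/eqP.
have out (xi : cochain X k) : (o \in rep_obs xi) = false.
  by apply/negP=> /rep_obs_gr e; rewrite e eqxx in no.
rewrite !out !add0r /multiplicity big1 // => P; rewrite inE => /rep_obs_gr gP.
case: eqP => // e; have := fc_pt_gr P; rewrite e gP subrK => go.
by rewrite go eqxx in no.
Qed.

Lemma cochain_addxx k (phi : cochain X k) : phi + phi = 0.
Proof. by apply/ffunP=> b; rewrite !ffunE addF2. Qed.

Lemma cochain_opp k (phi : cochain X k) : - phi = phi.
Proof. by apply/eqP; rewrite eq_sym -addr_eq0 cochain_addxx. Qed.

Section OfPointMatching.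
Variables (k : int) (phi : cochain X k) (M : matching pt).
Hypothesis okM : preserves (@fc_psrc X) (phi_points phi) M.

Let mM : matches (phi_points phi) M := proj1 okM.

Definition lead_pairs : {set pt * pt} :=
  [set (B, mate M B) | B in [set B in phi_points phi | lead M B]].

Lemma lead_pairsP B1 B2 : (B1, B2) \in lead_pairs ->
  B1 != B2 /\ exists b, B1 \in mod0_phi phi b /\ B2 \in mod0_phi phi b.
Proof.
case/imsetP=> B /setIdP[PB lB] [-> ->].
rewrite eq_sym (mate_neq mM PB); split=> //.
exists (fc_psrc B); have := mate_in mM PB; rewrite !mem_mod0_phi !inE eqxx.
case: okM => _ ->; rewrite // eqxx andbT; move: PB.
by rewrite inE andbT => -> ->.
Qed.

Lemma lead_pairs_partition b B : B \in mod0_phi phi b ->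
  #|[set p in lead_pairs | (B == p.1) || (B == p.2)]| = 1%N.
Proof.
rewrite mem_mod0_phi => /andP[tB _].
have PB : B \in phi_points phi by rewrite inE.
apply/eqP/cards1P.
exists (if lead M B then (B, mate M B) else (mate M B, B)).
apply/setP=> p; rewrite !inE; apply/andP/eqP.
  case=> /imsetP[B' /setIdP[PB' lB'] ->] /= /orP[]/eqP->; first by rewrite lB'.
  by rewrite (lead_mate mM) // lB' /= (mateK mM).
move->; case: ifP => lB /=; rewrite eqxx ?orbT; split=> //; apply/imsetP.
  by exists B; rewrite // inE PB.
exists (mate M B); last by rewrite (mateK mM).
by rewrite inE (mate_in mM) // (lead_mate mM) // lB.
Qed.

Definition bm_of_matching : boundary_matching phi :=
  BoundaryMatching lead_pairsP lead_pairs_partition.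

End OfPointMatching.

Section Existence.
Variables (k : int) (phi : cochain X k).
Hypothesis Zphi : phi \in cocycles X k.

(** The coboundary of phi at b is the number of points of M(b, phi). *)
Lemma cocycle_even : {in phi_points phi, forall B,
  ~~ odd #|[set B' in phi_points phi | fc_psrc B' == fc_psrc B]|}.
Proof.
move=> B; rewrite inE => tB.
have gB : fc_gr (fc_psrc B) == k + 1 by rewrite fc_pt_gr (rep_obs_gr tB).
have /ffunP/(_ (Sub (fc_psrc B) gB : obdeg X (k + 1))) := cocycleP _ Zphi.
rewrite (coboundaryE _ (g := fun c => (c \in rep_obs phi)%:F)) //; last first.
  exact: mem_rep_obs.
rewrite ffunE SubK => e.
suff : (odd #|[set B' in phi_points phi | fc_psrc B' == fc_psrc B]|)%:F = 0.
  by case: (odd _).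
rewrite oddF2 cardF2 -[RHS]e big_mkcond [RHS]big_mkcond; apply: eq_bigr => P _.
by rewrite inE; case: (_ \in _); case: (_ == _).
Qed.

Lemma pairing_preserves : preserves (@fc_psrc X) (phi_points phi)
  (pairing (@fc_psrc X) (phi_points phi)).
Proof.
split; first exact: pairing_matches cocycle_even.
by move=> B; apply: (pairing_fibre cocycle_even).
Qed.

Definition chosen_matching : boundary_matching phi :=
  bm_of_matching pairing_preserves.

End Existence.

(** Modulo 2, [sq C] is three times itself, and 0 + 0 + 0 is a coboundary. *)
Lemma sq_zero k (C : boundary_matching (0 : cochain X k)) :
  sq C \in coboundaries X (k + 2).
Proof.
rewrite -[sq C]add0r -(cochain_addxx (sq C)).
by apply: sq_triple; rewrite !addr0 mem0v.
Qed.

Lemma sq_pair k (phi psi : cochain X k) (C1 : boundary_matching phi)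
    (C2 : boundary_matching psi) :
  phi + psi \in coboundaries X k -> sq C1 + sq C2 \in coboundaries X (k + 2).
Proof.
move=> bd; pose C0 := chosen_matching (mem0v (cocycles X k)).
have := sq_triple C1 C2 C0; rewrite addr0 => /(_ bd) B3.
by rewrite -(addrK (sq C0) (sq C1 + sq C2)) rpredB // sq_zero.
Qed.

Lemma cohom_class_add k (phi psi : cochain X k) :
  cohom_class (phi + psi) = cohom_class phi + cohom_class psi.
Proof. by rewrite /cohom_class vquot_addE linearD. Qed.

Lemma cohom_classE k (phi psi : cochain X k) :
    phi \in cocycles X k -> psi \in cocycles X k ->
  cohom_class phi = cohom_class psi <-> phi + psi \in coboundaries X k.
Proof.
move=> Zphi Zpsi; rewrite -{2}[psi]cochain_opp; exact: cohom_class_eq.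
Qed.

Definition rep_cocycle k (z : cohomology X k) : cochain X k :=
  vsval (generic_quotient.repr z).

Lemma rep_cocycleP k (z : cohomology X k) : rep_cocycle z \in cocycles X k.
Proof. exact: subvsP. Qed.

Lemma cohom_class_rep k (z : cohomology X k) : cohom_class (rep_cocycle z) = z.
Proof. by rewrite /cohom_class vsvalK reprK. Qed.

Definition Sq2 k (z : cohomology X k) : cohomology X (k + 2) :=
  cohom_class (sq (chosen_matching (rep_cocycleP z))).

Lemma Sq2_class k (phi : cochain X k) (C : boundary_matching phi) :
  phi \in cocycles X k -> Sq2 (cohom_class phi) = cohom_class (sq C).
Proof.
move=> Zphi; apply/cohom_classE; try exact: sq_cocycle.
apply: sq_pair; apply/cohom_classE => //; first exact: rep_cocycleP.
exact: cohom_class_rep.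
Qed.

Lemma Sq2_linear k : linear (@Sq2 k).
Proof.
have add (u v : cohomology X k) : Sq2 (u + v) = Sq2 u + Sq2 v.
  rewrite /Sq2 -cohom_class_add; apply/cohom_classE.
  - exact: sq_cocycle.
  - by rewrite rpredD // sq_cocycle.
  rewrite [X in X \in _]addrA; apply: sq_triple.
  rewrite -[X in X \in _]addrA; apply/cohom_classE.
  - exact: rep_cocycleP.
  - by rewrite rpredD // rep_cocycleP.
  by rewrite cohom_class_add !cohom_class_rep.
move=> c u v; have [->|->] : c = 0 \/ c = 1 by exact: F2P.
  by rewrite !scale0r !add0r.
by rewrite !scale1r add.
Qed.

HB.instance Definition _ k := GRing.isLinear.Build _ _ _ _ (@Sq2 k) (@Sq2_linear k).

End CohomologyClasses.

Theorem theorem3p13 (X : framed_flow1cat) (k : int) :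
  [/\ (* sq^phi is a cocycle *)
      forall (phi : cochain X k) (C : boundary_matching phi),
        phi \in cocycles X k -> sq C \in cocycles X (k + 2),
      (* its class does not depend on the matching *)
      forall (phi : cochain X k) (C C' : boundary_matching phi),
        phi \in cocycles X k -> cohom_class (sq C) = cohom_class (sq C')
    & (* Sq^2 is a well-defined linear map; matchings exist *)
      exists Sq2 : {linear cohomology X k -> cohomology X (k + 2)},
        forall (z : cohomology X k) (phi : cochain X k),
          phi \in cocycles X k -> cohom_class phi = z ->
          inhabited (boundary_matching phi) /\
          forall C : boundary_matching phi, Sq2 z = cohom_class (sq C)].
Proof.
split=> [phi C _|phi C C' Zphi|]; first exact: sq_cocycle.
  by rewrite -!Sq2_class.
exists (@Sq2 X k) => z phi Zphi <-; split; first by exists; apply: chosen_matching.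
by move=> C; apply: Sq2_class.
Qed.
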